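(* The map $A\mapsto\mathrm{RSK}(A)=(P(u_A),P(v_A))$ is a bijection $$M_{m\times n}(\mathbf R^+)\;\longrightarrow\;\coprod_\lambda \mathrm{Tab}^\dagger_n(\lambda)\times\mathrm{Tab}^\dagger_m(\lambda),$$ where $\lambda$ runs over all real partitions with at most $\min(m,n)$ parts.
   Context: $M_{m\times n}(\mathbf R^+)$ is the set of $m\times n$ matrices with non-negative real entries. For $N\ge1$ let $A_N=\{1,\dots,N\}$ with its usual order. A timed word of length $r\ge0$ in $A_N$ is a right-continuous piecewise-constant function $w:[0,r)\to A_N$ with finitely many discontinuities; $l(w)=r$. We write $w=c_1^{t_1}\cdots c_k^{t_k}$ ($t_i\ge 0$; terms with $t_i=0$ are omitted) if $w$ takes value $c_i$ on $[t_1+\dots+t_{i-1},t_1+\dots+t_i)$; adjacent equal letters may be merged. Concatenation is the product; $\emptyset$ is the empty word. $w_{[a,b)}(t)=w(a+t)$ for $0\le t<b-a$. A timed row is a weakly increasing timed word. Every timed word has a unique row decomposition $w=u_l\cdots u_1$ into timed rows with $u_iu_{i-1}$ never a row. For timed rows, $u\lhd v$ means $l(u)\ge l(v)$ and $u(t)<v(t)$ for $0\le t<l(v)$. A real partition is a weakly decreasing finite sequence of non-negative reals, identified up to trailing zeros. A timed tableau is a timed word whose row decomposition satisfies $u_1\lhd\cdots\lhd u_l$; its shape is $(l(u_1),\dots,l(u_l))$; $\mathrm{Tab}^\dagger_N(\lambda)$ denotes timed tableaux in $A_N$ of shape $\lambda$. Timed row insertion: for a timed row $u$, a letter $c$ and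 $t_c\ge0$: if $u(t)\le c$ for all $t$, then $\mathrm{RINS}(u,c^{t_c})=(\emptyset,uc^{t_c})$; otherwise let $t_0=\min\{t: u(t)>c\}$ and set $\mathrm{RINS}(u,c^{t_c})=(u_{[t_0,t_0+t_c)},\,u_{[0,t_0)}c^{t_c}u_{[t_0+t_c,l(u))})$ if $l(u)-t_0>t_c$, and $=(u_{[t_0,l(u))},\,u_{[0,t_0)}c^{t_c})$ otherwise. For a row $v=c_1^{t_1}\cdots c_k^{t_k}$: if $(v',u')=\mathrm{RINS}(u,c_1^{t_1}\cdots c_{k-1}^{t_{k-1}})$ and $(v'',u'')=\mathrm{RINS}(u',c_k^{t_k})$, then $\mathrm{RINS}(u,v)=(v'v'',u'')$. Tableau insertion: for a timed tableau $w$ with rows $u_l\cdots u_1$ and a timed row $v$, put $v_0'=v$, $(v_i',u_i')=\mathrm{RINS}(u_i,v_{i-1}')$, and $\mathrm{INSERT}(w,v)=v_l'u_l'\cdots u_1'$. If $w=u_1u_2\cdots u_l$ is the row decomposition (rows listed left to right), $P(w)=\mathrm{INSERT}(\cdots\mathrm{INSERT}(\mathrm{INSERT}(u_1,u_2),u_3)\cdots,u_l)$. For $A=(a_{ij})\in M_{m\times n}(\mathbf R^+)$: $u_A=1^{a_{11}}2^{a_{12}}\cdots n^{a_{1n}}\,1^{a_{21}}\cdots n^{a_{2n}}\cdots1^{a_{m1}}\cdots n^{a_{mn}}\in A_n^\dagger$ and $v_A=1^{a_{11}}2^{a_{21}}\cdots m^{a_{m1}}\,1^{a_{12}}\cdots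 m^{a_{m2}}\cdots1^{a_{1n}}\cdots m^{a_{mn}}\in A_m^\dagger$; $\mathrm{RSK}(A)=(P(u_A),P(v_A))$. *)

(* Defs.v *)
From HB Require Import structures.
From mathcomp Require Import all_boot all_order all_algebra.
From mathcomp Require Import all_classical all_reals all_analysis.

Set Implicit Arguments.
Unset Strict Implicit.
Unset Printing Implicit Defensive.

Import Order.TTheory GRing.Theory Num.Theory.
Import numFieldNormedType.Exports.

Local Open Scope classical_set_scope.
Local Open Scope ring_scope.

(* The alphabet A_N = {1 < ... < N} is 'I_N; the ordinal i is the letter i+1. *)

(* Raw data of a function [0, tlen) -> A_N: for a genuine timed word (predicate
   [timed_word] below) tval t = Some (w t) on [0, tlen) and tval t = None
   elsewhere, so that Leibniz equality is equality of timed words. *)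
Record tword (R : realType) (N : nat) :=
  TWord { tlen : R ; tval : R -> option 'I_N }.

HB.instance Definition _ (R : realType) (N : nat) := gen_eqMixin (tword R N).
HB.instance Definition _ (R : realType) (N : nat) := gen_choiceMixin (tword R N).

Section TimedWords.
Context {R : realType} {N : nat}.
Implicit Types (u v w : tword R N) (c : 'I_N) (t : R).

(* Continuity for the subspace topology on [0, tlen w) and the discrete
   topology on the alphabet. *)
Definition word_continuous_at w t : Prop :=
  \forall s \near t, 0 <= s < tlen w -> tval w s = tval w t.

Definition word_right_continuous_at w t : Prop :=
  \forall s \near t^'+, 0 <= s < tlen w -> tval w s = tval w t.

(* As the alphabet is discrete, finitely many discontinuities already means
   piecewise constant. *)
Definition timed_word w : Prop :=
  [/\ 0 <= tlen w,
      forall t, tval w t <> None <-> 0 <= t < tlen w,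
      forall t, 0 <= t < tlen w -> word_right_continuous_at w t &
      finite_set [set t | 0 <= t < tlen w /\ ~ word_continuous_at w t]].

Definition tempty : tword R N := TWord 0 (fun=> None).

Definition tcat u v : tword R N :=
  TWord (tlen u + tlen v)
        (fun t => if t < tlen u then tval u t else tval v (t - tlen u)).

Definition tpow c t : tword R N :=
  TWord t (fun s => if 0 <= s < t then Some c else None).

(* w_[a,b) *)
Definition tsub w (a b : R) : tword R N :=
  TWord (b - a) (fun t => if 0 <= t < b - a then tval w (a + t) else None).

Definition tconcat (s : seq (tword R N)) : tword R N := foldr tcat tempty s.

(* c_1^{t_1} ... c_k^{t_k} *)
Definition texp (s : seq ('I_N * R)) : tword R N :=
  tconcat [seq tpow ct.1 ct.2 | ct <- s].

Definition reduced (s : seq ('I_N * R)) : bool :=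
  all (fun ct => 0 < ct.2) s && sorted (fun ct ct' => ct.1 != ct'.1) s.

(* The expression c_1^{t_1} ... c_k^{t_k} of a timed word in which all t_i are
   positive and adjacent letters are distinct; every timed word has exactly
   one. *)
Definition texpr w : seq ('I_N * R) :=
  xget [::] [set s | reduced s /\ texp s = w].

Definition timed_row w : Prop :=
  timed_word w /\
  forall s t a b, s <= t -> tval w s = Some a -> tval w t = Some b -> (a <= b)%N.

(* Lists of rows follow the word from left to right: w = u_l ... u_1 is
   [:: u_l; ...; u_1]. The rows are nonempty, so the empty word has l = 0. *)
Definition is_row_decomposition w (s : seq (tword R N)) : Prop :=
  [/\ tconcat s = w,
      forall u, u \in s -> timed_row u /\ 0 < tlen u &
      forall i, (i.+1 < size s)%N ->
        ~ timed_row (tcat (nth tempty s i) (nth tempty s i.+1))].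

Definition rows w : seq (tword R N) := xget [::] [set s | is_row_decomposition w s].

(* u <| v *)
Definition dominates u v : Prop :=
  tlen v <= tlen u /\
  forall t, 0 <= t < tlen v ->
    exists a b, [/\ tval u t = Some a, tval v t = Some b & (a < b)%N].

Definition timed_tableau w : Prop :=
  timed_word w /\
  let us := rev (rows w) in
  forall i, (i.+1 < size us)%N ->
    dominates (nth tempty us i) (nth tempty us i.+1).

Definition shape w : seq R := [seq tlen u | u <- rev (rows w)].

(* RINS(u, c^tc). By right-continuity the set of t with u(t) > c has a minimum
   whenever it is nonempty; it is then its infimum. *)
Definition rins1 u c (tc : R) : tword R N * tword R N :=
  if `[< forall t d, tval u t = Some d -> (d <= c)%N >] then
    (tempty, tcat u (tpow c tc))
  else
    let t0 := inf [set t | exists2 d, tval u t = Some d & (c < d)%N] in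
    if tc < tlen u - t0 then
      (tsub u t0 (t0 + tc),
       tcat (tcat (tsub u 0 t0) (tpow c tc)) (tsub u (t0 + tc) (tlen u)))
    else
      (tsub u t0 (tlen u), tcat (tsub u 0 t0) (tpow c tc)).

Definition rins u v : tword R N * tword R N :=
  foldl (fun p ct => let q := rins1 p.2 ct.1 ct.2 in (tcat p.1 q.1, q.2))
        (tempty, u) (texpr v).

(* us = [:: u_1; ...; u_l]; the result is v_l' u_l' ... u_1'. *)
Fixpoint insert_rows (us : seq (tword R N)) v : tword R N :=
  if us is u :: us' then
    let p := rins u v in tcat (insert_rows us' p.1) p.2
  else v.

Definition insert w v : tword R N := insert_rows (rev (rows w)) v.

Definition Ptab w : tword R N :=
  if rows w is u :: us then foldl insert u us else tempty.

End TimedWords.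

Definition Tab (R : realType) (N : nat) (l : seq R) : set (tword R N) :=
  [set w | timed_tableau w /\ shape w = l].

(* A real partition is represented by its sequence of nonzero parts, the
   canonical representative modulo trailing zeros; the number of parts is then
   the size. *)
Definition real_partition (R : realType) (l : seq R) : bool :=
  all (fun x => 0 < x) l && sorted (fun x y => y <= x) l.

Definition nonneg_matrices (R : realType) (m n : nat) : set 'M[R]_(m, n) :=
  [set A | forall i j, 0 <= A i j].

Definition u_word (R : realType) (m n : nat) (A : 'M[R]_(m, n)) : tword R n :=
  texp [seq (j, A i j) | i <- enum 'I_m, j <- enum 'I_n].

Definition v_word (R : realType) (m n : nat) (A : 'M[R]_(m, n)) : tword R m :=
  texp [seq (i, A i j) | j <- enum 'I_n, i <- enum 'I_m].

Definition RSK (R : realType) (m n : nat) (A : 'M[R]_(m, n)) :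
  tword R n * tword R m := (Ptab (u_word A), Ptab (v_word A)).

(* Main.v *)
(* A row is encoded by its cumulative vector X (X j is the length of its letters
   < j). Inserting the row Y into the row X leaves the row Z given by
   Z_{j+1} = max(Z_j, X_{j+1}) + (Y_{j+1} - Y_j), and bumps X + Y - Z.
   Reading a tableau instead as the chain of shapes of its subtableaux of letters
   < j, i.e. as a Gelfand-Tsetlin pattern, this recursion becomes a local rule
   computing the shape G(i+1,j+1) of the first i+1 rows and j+1 columns of A from
   G(i,j), G(i,j+1), G(i+1,j) and the entry a(i,j). The local rule is symmetric
   under transposition, so the growth diagram G of A has P(u_A) as its last row
   and P(v_A) as its last column; and it is invertible, so that G and A can be
   rebuilt from any two patterns with the same final shape. *)

From mathcomp Require Import all_boot all_order all_algebra.
From mathcomp Require Import all_classical all_reals all_analysis.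
From mathcomp Require Import ring lra zify.
(* After mathcomp, so that tval is the field of tword and not that of tuples. *)
Require Import Defs.

Set Implicit Arguments.
Unset Strict Implicit.
Unset Printing Implicit Defensive.

Import Order.TTheory GRing.Theory Num.Theory.

Local Open Scope classical_set_scope.
Local Open Scope ring_scope.

(** * Local rule and growth diagrams over the reals *)

Section LocalRule.
Context {R : realType}.
Implicit Types (l mu nu : nat -> R) (T : nat -> nat -> R).

(** [Ptab] inserts the rows of the row decomposition of [u_word A], and these are not the rows of
    the matrix: null rows vanish, and adjacent rows merge whenever their concatenation is weakly
    increasing. The growth diagram needs one step per matrix row. Additivity ([insD]) reconciles the
    two: inserting a row at once or in two pieces gives the same tableau, hence [Ptab] may be
    computed from any factorization into rows, empty ones included. The rule uses only max, min,
    addition and subtraction, so it is inverted directly over the reals, without any limit from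
    integer matrices. Analysis is needed mainly to show that a right-continuous word with finitely
    many jumps is a finite product of rows ([timed_word_rows]); from there on vectors replace words.
    Row decompositions and reduced expressions are chosen by [xget], so they are computed by
    exhibiting a candidate and proving uniqueness. *)

Definition interlace l mu := forall k, l k <= mu k /\ mu k.+1 <= l k.

(** The piecewise-linear form of Fomin's local rule: the first part absorbs the entry [a], each
    later part the amount bumped out of the part before it. *)
Definition local_rule l nu mu (a : R) (k : nat) : R :=
  Num.max (mu k) (nu k) +
  (if k is i.+1 then Num.min (mu i) (nu i) - l i else a).

Lemma local_rule_sym l nu mu (a : R) : local_rule l nu mu a = local_rule l mu nu a.
Proof.
by apply/funext => -[|k]; rewrite /local_rule maxC // [Num.min (mu _) _]minC.
Qed.

(** The term added to the max is nonnegative, which gives the lower bound. For the upper one,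
    [mu k.+1] and [nu k.+1] are both at most [l k], so part [k.+1] of the new shape is at most the
    minimum of [mu k] and [nu k]. *)
Lemma local_rule_interlace l nu mu (a : R) : interlace l nu -> interlace l mu ->
  0 <= a -> interlace mu (local_rule l nu mu a).
Proof.
move=> hn hm a0 k; rewrite /local_rule; split; last first.
  have [_ h1] := hn k; have [_ h2] := hm k.
  by case: (leP (mu k.+1) (nu k.+1)); case: (leP (mu k) (nu k)) => *; lra.
case: k => [|k]; first by case: (leP (mu 0%N) (nu 0%N)) => *; lra.
have [h1 _] := hn k; have [h2 _] := hm k.
by case: (leP (mu k.+1) (nu k.+1)); case: (leP (mu k) (nu k)) => *; lra.
Qed.

Lemma local_rule_id l mu : interlace l mu -> local_rule l l mu 0 = mu.
Proof.
move=> h; apply/funext => -[|k]; rewrite /local_rule.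
  by have [? _] := h 0%N; rewrite max_l// addr0.
have [? _] := h k; have [? _] := h k.+1.
by rewrite max_l// min_r// subrr addr0.
Qed.

(** The index shifts by one: [rho k.+1] gives back [l k], which leaves [rho 0] for the entry [a]. *)
Definition local_unrule nu mu rho (k : nat) : R :=
  Num.min (mu k) (nu k) + Num.max (mu k.+1) (nu k.+1) - rho k.+1.

Lemma local_ruleK l nu mu a :
  local_unrule nu mu (local_rule l nu mu a) = l /\
  local_rule l nu mu a 0%N - Num.max (mu 0%N) (nu 0%N) = a.
Proof.
split; last by rewrite /local_rule; ring.
by apply/funext => k; rewrite /local_unrule /local_rule; ring.
Qed.

Lemma local_unruleK nu mu rho :
  local_rule (local_unrule nu mu rho) nu mu
    (rho 0%N - Num.max (mu 0%N) (nu 0%N)) = rho.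
Proof. by apply/funext => -[|k]; rewrite /local_unrule /local_rule; ring. Qed.

Lemma local_unrule_sym l nu mu : local_unrule l nu mu = local_unrule nu l mu.
Proof.
apply/funext => k; rewrite /local_unrule [Num.max (nu _) _]maxC.
by rewrite [Num.min (nu _) _]minC.
Qed.

(** Interlacing puts [rho k.+1] between the maximum of [mu k.+1], [nu k.+1] and the minimum of
    [mu k], [nu k]; the result at [k] is its reflection in that interval. *)
Lemma local_unrule_interlace nu mu rho : interlace nu rho -> interlace mu rho ->
  interlace (local_unrule nu mu rho) mu.
Proof.
move=> hn hm k; rewrite /local_unrule.
have [h1 h2] := hn k; have [h3 h4] := hm k.
have [h5 h6] := hn k.+1; have [h7 h8] := hm k.+1.
by split; case: (leP (mu k.+1) (nu k.+1)); case: (leP (mu k) (nu k)) => *; lra.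
Qed.

Lemma interlace0 l : interlace l (fun=> 0) -> l = fun=> 0.
Proof.
by move=> h; apply/funext => k; have [h1 h2] := h k; apply/eqP; rewrite eq_le h1.
Qed.

Definition growth_diagram m n (a : nat -> nat -> R) (G : nat -> nat -> nat -> R) :=
  [/\ forall j, (j <= n)%N -> G 0%N j = fun=> 0,
      forall i, (i <= m)%N -> G i 0%N = fun=> 0 &
      forall i j, (i < m)%N -> (j < n)%N ->
        G i.+1 j.+1 = local_rule (G i j) (G i j.+1) (G i.+1 j) (a i j)].

Lemma growth_diagram_uniq m n a G G' :
  growth_diagram m n a G -> growth_diagram m n a G' ->
  forall i j, (i <= m)%N -> (j <= n)%N -> G i j = G' i j.
Proof.
move=> [g1 g2 g3] [h1 h2 h3]; elim=> [|i IHi] j him hjn.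
  by rewrite g1// h1.
elim: j hjn => [|j IHj] hjn; first by rewrite g2// h2.
rewrite g3// h3//.
by rewrite !IHi ?IHj// ltnW.
Qed.

Lemma growth_diagram_tr m n a G : growth_diagram m n a G ->
  growth_diagram n m (fun i j => a j i) (fun i j => G j i).
Proof.
by move=> [g1 g2 g3]; split=> // i j hi hj; rewrite local_rule_sym g3.
Qed.

Lemma growth_diagram_inj m n a a' G G' :
  growth_diagram m n a G -> growth_diagram m n a' G' ->
  (forall j, (j <= n)%N -> G m j = G' m j) ->
  (forall i, (i <= m)%N -> G i n = G' i n) ->
  forall i j, (i < m)%N -> (j < n)%N -> a i j = a' i j.
Proof.
move=> [g1 g2 g3] [h1 h2 h3] em en.
(* Recursion from the corner [(m, n)]: [d] and [e] are the distances to the last row and the last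
   column, where the diagrams agree by hypothesis. *)
have E : forall d e i j, (i + d = m)%N -> (j + e = n)%N -> G i j = G' i j.
  elim=> [|d IHd] e i j hi.
    by rewrite addn0 in hi; rewrite hi => hj; apply: em; lia.
  elim: e j => [|e IHe] j hj.
    by rewrite addn0 in hj; rewrite hj; apply: en; lia.
  have hi' : (i < m)%N by lia.
  have hj' : (j < n)%N by lia.
  rewrite -[LHS](local_ruleK _ (G i j.+1) (G i.+1 j) (a i j)).1 -g3//.
  rewrite -[RHS](local_ruleK _ (G' i j.+1) (G' i.+1 j) (a' i j)).1 -h3//.
  by rewrite IHe ?(IHd e.+1 i.+1 j) ?(IHd e i.+1 j.+1) //; lia.
move=> i j hi hj.
have E' i' j' : (i' <= m)%N -> (j' <= n)%N -> G i' j' = G' i' j'.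
  by move=> ? ?; apply: (E (m - i')%N (n - j')%N); lia.
rewrite -(local_ruleK (G i j) (G i j.+1) (G i.+1 j) (a i j)).2 -g3//.
rewrite -(local_ruleK (G' i j) (G' i j.+1) (G' i.+1 j) (a' i j)).2 -h3//.
by rewrite !E' // ltnW.
Qed.

Definition gt_chain n T :=
  T 0%N = (fun=> 0) /\ forall j, (j < n)%N -> interlace (T j) (T j.+1).

(** The last row of a diagram is peeled off cell by cell, from right to left. The left end of [L]
    vanishes by itself, because it interlaces with [T 0], which is zero. *)
Lemma unrule_row n T l : gt_chain n T -> interlace l (T n) ->
  exists (L : nat -> nat -> R) (a : nat -> R),
    [/\ gt_chain n L, L n = l, forall j, (j < n)%N -> 0 <= a j &
        forall j, (j < n)%N ->
          T j.+1 = local_rule (L j) (L j.+1) (T j) (a j)].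
Proof.
elim: n l => [|n IH] l [T0 hT] hl.
  exists (fun=> l), (fun=> 0); split=> //; split=> //.
  by apply: interlace0; rewrite -T0.
have hTn := hT n (ltnSn n).
have h1 := local_unrule_interlace hl hTn.
have h2 := local_unrule_interlace hTn hl; rewrite local_unrule_sym in h2.
have hT' : gt_chain n T by split=> // j hj; apply: hT; lia.
have [L [a [[L0 hL] Ln ha hr]]] := IH _ hT' h1.
exists (fun j => if j == n.+1 then l else L j).
exists (fun j => if j == n then T n.+1 0%N - Num.max (T n 0%N) (l 0%N) else a j).
split=> [|//||].
- split=> // j; rewrite ltnS leq_eqVlt => /orP[/eqP->|hj].
    by rewrite eqxx ifF ?Ln//; lia.
  by rewrite !ifF; [exact: hL | lia | lia].
- by rewrite eqxx.
- move=> j; rewrite ltnS leq_eqVlt => /orP[/eqP->|hj].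
    rewrite eqxx subr_ge0 ge_max; have [? _] := hTn 0%N.
    by have [? _] := hl 0%N; apply/andP.
  by rewrite ifF; [exact: ha | lia].
- move=> j; rewrite ltnS leq_eqVlt => /orP[/eqP->|hj].
    by rewrite !eqxx ifF ?Ln ?local_unruleK//; lia.
  by rewrite !ifF; [exact: hr | lia..].
Qed.

Lemma growth_diagram_surj m n S T : gt_chain n T -> gt_chain m S -> T n = S m ->
  exists a G, [/\ growth_diagram m n a G, forall i j, 0 <= a i j,
    forall j, (j <= n)%N -> G m j = T j & forall i, (i <= m)%N -> G i n = S i].
Proof.
elim: m T => [|m IH] T cT [S0 hS] eTS.
  (* Without rows every shape is zero: [T n = S 0 = 0], and interlacing carries this down the
     chain. *)
  have T0 j : (j <= n)%N -> T j = fun=> 0.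
    move=> hj; have [e ->] : exists e, j = (n - e)%N by exists (n - j)%N; lia.
    elim: e => [|e IHe]; first by rewrite subn0 eTS.
    have [hne|hne] := leqP n e.
      by have -> : (n - e.+1 = n - e)%N by lia.
    apply: interlace0; rewrite -IHe.
    have := cT.2 (n - e.+1)%N; have -> : ((n - e.+1).+1 = n - e)%N by lia.
    by apply; lia.
  exists (fun _ _ => 0), (fun _ => T); split=> //.
  - by split=> [j hj|i _|//]; [exact: T0 | exact: cT.1].
  - by move=> i; rewrite leqn0 => /eqP ->; rewrite eTS.
have [|L [r [cL Ln hr hrule]]] := unrule_row (l := S m) cT.
  by rewrite eTS; exact: hS.
have cS : gt_chain m S by split=> // i hi; apply: hS; lia.
have [a [G [[g1 g2 g3] a0 GL GS]]] := IH L cL cS Ln.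
(* The entries [r j] are known to be nonnegative for [j < n] only, hence the default 0. *)
exists (fun i j => if i == m then if (j < n)%N then r j else 0 else a i j).
exists (fun i => if i == m.+1 then T else G i); split.
- split=> [j hj|i hi|i j hi hj]; first exact: g1.
  + case: eqP => [_|/eqP hi']; first exact: cT.1.
    by apply: g2; lia.
  + rewrite eqSS; move: hi; rewrite ltnS leq_eqVlt => /orP[/eqP->|hi].
      by rewrite eqxx hj ifF ?hrule ?GL ?(ltnW hj)//; lia.
    by rewrite !ifF; [exact: g3 | lia..].
- move=> i j; case: eqP => [_|_]; last exact: a0.
  by case: ifP => // hj; exact: hr.
- by move=> j hj; rewrite eqxx.
- move=> i hi; case: eqP => [->//|/eqP hi']; apply: GS; lia.
Qed.

End LocalRule.

(** * Row and tableau insertion on cumulative vectors *)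

Section RowVectors.
Context {R : realType} (N : nat).
Implicit Types (X Y Z : nat -> R) (T : nat -> nat -> R).

(* X j is the total length of the letters < j of a row in A_N. *)
Definition row_vec X :=
  [/\ X 0%N = 0, forall j, X j <= X j.+1 & forall j, (N <= j)%N -> X j = X N].

Lemma row_vec_homo X : row_vec X -> forall i j, (i <= j)%N -> X i <= X j.
Proof. by case=> _ hX _; apply: (homo_leq (r := <=%O)) => // ? ? ?; exact: le_trans. Qed.

Lemma row_vec_ge0 X : row_vec X -> forall j, 0 <= X j.
Proof. by move=> hX j; have [<- _ _] := hX; exact: row_vec_homo. Qed.

Lemma row_vec_leN X : row_vec X -> forall j, X j <= X N.
Proof.
move=> hX j; have [hj|hj] := leqP N j; first by case: hX => _ _ ->.
by apply: row_vec_homo => //; exact: ltnW.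
Qed.

Lemma row_vec0 : row_vec (fun=> 0). Proof. by split. Qed.

Lemma row_vec_eq0 X : row_vec X -> X N = 0 -> X = fun=> 0.
Proof.
move=> hX X0; apply/funext => j; apply/eqP.
by rewrite eq_le row_vec_ge0// andbT -X0 row_vec_leN.
Qed.

Lemma row_vecD X Y : row_vec X -> row_vec Y -> row_vec (fun j => X j + Y j).
Proof.
move=> [X0 hX XN] [Y0 hY YN]; split; first by rewrite X0 Y0 addr0.
- by move=> j; apply: lerD.
- by move=> j hj; rewrite XN// YN.
Qed.

(* In cumulative form, the letters left in, resp. bumped out of, the row X
   after the row Y is inserted. *)
Fixpoint rins_vec X Y (j : nat) : R :=
  if j is i.+1 then Num.max (rins_vec X Y i) (X i.+1) + (Y i.+1 - Y i) else 0.

Definition bump_vec X Y (j : nat) : R := X j + Y j - rins_vec X Y j.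

Lemma rins_vec_ge X Y : row_vec X -> row_vec Y -> forall j, X j <= rins_vec X Y j.
Proof.
move=> [X0 hX _] [_ hY _] [|j] /=; first by rewrite X0.
by have := hY j; case: (leP (rins_vec X Y j) (X j.+1)) => *; lra.
Qed.

Lemma row_vec_rins X Y : row_vec X -> row_vec Y -> row_vec (rins_vec X Y).
Proof.
move=> hX hY; have [X0 hX' XN] := hX; have [Y0 hY' YN] := hY; split=> //.
  by move=> j /=; have := hY' j; case: (leP (rins_vec X Y j) (X j.+1)) => *; lra.
move=> j; elim: j => [|j IH]; first by rewrite leqn0 => /eqP->.
rewrite leq_eqVlt => /orP[/eqP->//|]; rewrite ltnS => hj.
rewrite /= IH// (YN j)// (YN j.+1) ?(leqW hj)// (XN j.+1) ?(leqW hj)//.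
by rewrite subrr addr0 max_l// rins_vec_ge.
Qed.

(** The letters [j] of [X] fill [[X j, X j.+1)], and those left of [rins_vec X Y j] are displaced by
    smaller letters. This increment is the min term of the local rule. *)
Lemma bump_vecS X Y j :
  bump_vec X Y j.+1 - bump_vec X Y j = Num.min (X j.+1) (rins_vec X Y j) - X j.
Proof. by rewrite /bump_vec /=; case: leP => *; ring. Qed.

Lemma row_vec_bump X Y : row_vec X -> row_vec Y -> row_vec (bump_vec X Y).
Proof.
move=> hX hY; have [X0 hX' XN] := hX; have [Y0 hY' YN] := hY; split.
- by rewrite /bump_vec X0 Y0 /=; lra.
- move=> j; rewrite -subr_ge0 bump_vecS subr_ge0 le_min hX' /=.
  exact: rins_vec_ge.
- move=> j hj; rewrite /bump_vec XN// YN//.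
  by have [_ _ ->] := row_vec_rins hX hY.
Qed.

Lemma rins_vecX0 X : row_vec X -> rins_vec X (fun=> 0) = X.
Proof.
move=> [X0 hX _]; apply/funext; elim=> [//|j IH] /=.
by rewrite IH subrr addr0 max_r.
Qed.

Lemma rins_vec0Y Y : row_vec Y -> rins_vec (fun=> 0) Y = Y.
Proof.
move=> hY; apply/funext; elim=> [|j IH] /=; first by case: hY.
by rewrite IH max_l ?row_vec_ge0//; ring.
Qed.

(* The rows with vectors X and Y concatenate to a row. *)
Definition concat_row X Y := forall j, X j = X N \/ Y j = 0.

Section Additivity.
Variables X Y Y' : nat -> R.
Hypotheses (hX : row_vec X) (hY : row_vec Y) (hY' : row_vec Y').
Hypothesis hYY' : concat_row Y Y'.
Let Z := rins_vec X Y.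
Let hZ : row_vec Z := row_vec_rins hX hY.

Let Z'_eq j : Y' j = 0 -> rins_vec Z Y' j = Z j.
Proof.
elim: j => [//|j IH] h /=.
have h' : Y' j = 0.
  by apply/eqP; rewrite eq_le row_vec_ge0// andbT -h; case: hY'.
by rewrite IH// h h' subrr addr0 max_r//; case: hZ.
Qed.

Let step j : Y j.+1 = Y j \/ Y' j = 0.
Proof.
have [e|e] := hYY' j; [left|by right].
apply/eqP; rewrite eq_le; case: (hY) => _ -> _; rewrite e andbT.
exact: row_vec_leN.
Qed.

(** At each [j], either [Y] has no letter [j] or [Y'] has no letter below [j] ([step]). In the first
    case [Z j.+1] is a plain max, absorbed since [Z j] is at most [rins_vec Z Y' j]; in the second
    the two recursions have not yet diverged. *)
Lemma rins_vecD : rins_vec X (fun j => Y j + Y' j) = rins_vec Z Y'.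
Proof.
apply/funext; elim=> [//|j IH]; rewrite /= IH.
have h1 := rins_vec_ge hZ hY' j.
have [e|e] := step j.
  have ZS : Z j.+1 = Num.max (Z j) (X j.+1) by rewrite /Z /= e; ring.
  rewrite ZS maxA.
  by rewrite [Num.max (rins_vec _ _ _) (Z j)]max_l// e; ring.
have h2 := Z'_eq e; rewrite h2.
have [_ hYj _] := hY; have := hYj j.
by rewrite /Z /= -/(Z j); case: (leP (Z j) (X j.+1)) => *; rewrite max_r; lra.
Qed.

Lemma bump_vecD :
  bump_vec X (fun j => Y j + Y' j) = (fun j => bump_vec X Y j + bump_vec Z Y' j).
Proof. by apply/funext => j; rewrite /bump_vec rins_vecD -/Z; ring. Qed.

(** This is what lets additivity pass to the next row of a tableau. *)
Lemma concat_row_bump : concat_row (bump_vec X Y) (bump_vec Z Y').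
Proof.
move=> j.
have [Y0|/eqP Y'n0] := eqVneq (Y' j) 0.
  by right; rewrite /bump_vec Z'_eq// Y0; ring.
have [Yj|//] := hYY' j.
(* Here [Y] is exhausted at [j]. If moreover [X] and [Z] agree at [j], they agree from [j] on and
   [Y] bumps nothing more. *)
have [XZ|XZ] := eqVneq (X j) (Z j).
  left.
  have hi i : (j <= i)%N -> X i = Z i /\ bump_vec X Y i = bump_vec X Y j.
    elim: i => [|i IH]; first by rewrite leqn0 => /eqP <-.
    rewrite leq_eqVlt => /orP[/eqP <-//|]; rewrite ltnS => hi.
    have [XZi Bi] := IH hi.
    have Yi : Y i.+1 - Y i = 0.
      apply/eqP; rewrite subr_eq0 eq_le; case: (hY) => _ -> _; rewrite andbT.
      by rewrite (le_trans (row_vec_leN hY _))// -Yj row_vec_homo.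
    split; first by rewrite /Z /= Yi addr0 -/(Z i) -XZi max_r//; case: hX.
    apply/eqP; rewrite -Bi -subr_eq0 bump_vecS -/(Z i) -XZi min_r ?subrr//.
    by case: hX.
  have [hj|hj] := leqP j N; first by rewrite (hi N hj).2.
  by have [_ _ ->] := row_vec_bump hX hY; rewrite // ltnW.
(* Otherwise [X j < Z j]. Going down from [j], where [Y] has no letter the strict inequality forces
   [Z] to be constant, so [Y'] finds no letter to bump there; where [Y] has one, [Y'] has not
   started. *)
right.
have : X j < Z j by rewrite lt_neqAle XZ rins_vec_ge.
move: Yj; clear Y'n0 XZ; elim: j => [|j IH] Yj.
  by rewrite /Z /=; case: hX => ->; rewrite ltxx.
move=> XZ.
have B'E : bump_vec Z Y' j.+1 =
    bump_vec Z Y' j + (Num.min (Z j.+1) (rins_vec Z Y' j) - Z j).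
  by rewrite -bump_vecS; ring.
rewrite B'E.
have [e|e] := step j; last first.
  rewrite Z'_eq// min_r; last by case: hZ.
  by rewrite /bump_vec Z'_eq// e; ring.
have Z1 : Z j.+1 = Z j.
  have ZS : Z j.+1 = Num.max (Z j) (X j.+1) by rewrite /Z /= e; ring.
  by move: XZ; rewrite ZS; case: (leP (Z j) (X j.+1)) => //; rewrite ltxx.
rewrite IH; first by rewrite Z1 min_l ?rins_vec_ge//; ring.
  by rewrite -e.
by rewrite -Z1; apply: le_lt_trans XZ; case: hX.
Qed.

End Additivity.

Fixpoint carry T Y (k : nat) : nat -> R :=
  if k is i.+1 then bump_vec (T^~ i) (carry T Y i) else Y.

(* Row k of the tableau T is T^~ k, so that T j is the shape of the subtableau
   of the letters < j. *)
Definition ins T Y : nat -> nat -> R := fun j k => rins_vec (T^~ k) (carry T Y k) j.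

(** The two halves of [interlace] say that the rows are cumulative vectors and that adjacent rows
    are column strict. *)
Definition tab_vec T :=
  [/\ T 0%N = (fun=> 0), forall j, interlace (T j) (T j.+1) &
      forall j, (N <= j)%N -> T j = T N].

Lemma tab_vec_row T k : tab_vec T -> row_vec (T^~ k).
Proof.
move=> [T0 hT TN]; split; first by rewrite T0.
- by move=> j; have [] := hT j k.
- by move=> j hj; rewrite TN.
Qed.

Lemma tab_vec0 : tab_vec (fun _ _ => 0). Proof. by split. Qed.

(** Column strictness moves along the diagonal [(j, k)], [(j-1, k-1)], ... down to [T 0]. In
    particular at most [N] rows are nonempty. *)
Lemma tab_vec_eq0 T j k : tab_vec T -> (j <= k)%N -> T j k = 0.
Proof.
move=> hT; elim: k j => [|k IH] j.
  by rewrite leqn0 => /eqP->; case: hT => ->.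
case: j => [|j]; first by case: hT => ->.
rewrite ltnS => hjk; apply/eqP.
rewrite eq_le (row_vec_ge0 (tab_vec_row _ hT)) andbT -(IH _ hjk).
by case: hT => _ h _; have [] := h j k.
Qed.

Lemma tab_vec_nonincr T j k k' : tab_vec T -> (k <= k')%N -> T j k' <= T j k.
Proof.
move=> hT; have h i : T j i.+1 <= T j i.
  case: hT => T0 hT _; case: j => [|j]; first by rewrite T0.
  have [_ h1] := hT j i; have [h2 _] := hT j i; exact: le_trans h2.
elim: k' => [|k' IH]; first by rewrite leqn0 => /eqP->.
rewrite leq_eqVlt => /orP[/eqP->//|]; rewrite ltnS => /IH; exact: le_trans.
Qed.

Lemma row_vec_carry T Y k : tab_vec T -> row_vec Y -> row_vec (carry T Y k).
Proof.
by move=> hT hY; elim: k => //= k IH; apply: row_vec_bump => //; exact: tab_vec_row.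
Qed.

(** Row 0 is the recursion of [rins_vec]. Into row [k.+1] goes what row [k] bumps, whose increment
    at [j] is the min term by [bump_vecS]. *)
Lemma ins_rule T Y j : row_vec Y -> tab_vec T ->
  ins T Y j.+1 = local_rule (T j) (T j.+1) (ins T Y j) (Y j.+1 - Y j).
Proof.
move=> hY hT; apply/funext => -[|k]; rewrite /local_rule /ins /=; first by [].
by congr (_ + _); rewrite bump_vecS minC.
Qed.

Lemma tab_vec_ins T Y : tab_vec T -> row_vec Y -> tab_vec (ins T Y).
Proof.
move=> hT hY; have [T0 hT' TN] := hT; have [Y0 hY' YN] := hY.
have h j : interlace (T j) (ins T Y j).
  elim: j => [|j IH]; first by move=> k; rewrite T0 /ins /=.
  rewrite ins_rule// local_rule_sym.
  by apply: local_rule_interlace; rewrite // subr_ge0.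
split=> //; first by move=> j; rewrite ins_rule//;
  apply: local_rule_interlace; rewrite // subr_ge0.
elim=> [|j IH]; first by rewrite leqn0 => /eqP->.
rewrite leq_eqVlt => /orP[/eqP->//|]; rewrite ltnS => hj.
rewrite ins_rule// (YN j)// (YN j.+1) ?(leqW hj)// (TN j.+1) ?(leqW hj)//.
by rewrite (TN j)// subrr (IH hj) local_rule_id.
Qed.

(** Bumping strictly raises letters; at [k = N] nothing is carried out of the last row. *)
Lemma carry_eq0 T Y j k : tab_vec T -> row_vec Y -> (j <= k)%N -> carry T Y k j = 0.
Proof.
move=> hT hY; elim: k j => [|k IH] j.
  by rewrite leqn0 => /eqP->; case: hY.
have h0 : forall i, (i <= k)%N -> rins_vec (T^~ k) (carry T Y k) i = 0.
  elim=> [//|i IHi] hi /=.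
  by rewrite IHi ?(ltnW hi)// !IH ?(ltnW hi)// tab_vec_eq0// maxxx subrr addr0.
rewrite leq_eqVlt => /orP[/eqP->|hj].
  have Tk : 0 <= T k.+1 k by apply: row_vec_ge0 (tab_vec_row _ hT) _.
  by rewrite /= /bump_vec /= h0// max_r// (IH k)//; ring.
by rewrite /= /bump_vec h0// IH// tab_vec_eq0//; ring.
Qed.

Lemma ins0 T : tab_vec T -> ins T (fun=> 0) = T.
Proof.
move=> hT.
have h k : carry T (fun=> 0) k = fun=> 0.
  elim: k => //= k ->; apply/funext => j.
  by rewrite /bump_vec rins_vecX0 ?addr0 ?subrr//; exact: tab_vec_row.
apply/funext => j; apply/funext => k.
by rewrite /ins h rins_vecX0//; exact: tab_vec_row.
Qed.

(** Row by row, the two pieces bump rows that again concatenate to a row, so [rins_vecD] applies at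
    every level. *)
Lemma insD T Y Y' : tab_vec T -> row_vec Y -> row_vec Y' -> concat_row Y Y' ->
  ins T (fun j => Y j + Y' j) = ins (ins T Y) Y'.
Proof.
move=> hT hY hY' hYY'.
have hc k : row_vec (carry T Y k) by exact: row_vec_carry.
have hc' k : row_vec (carry (ins T Y) Y' k).
  by apply: row_vec_carry => //; exact: tab_vec_ins.
have hr k := tab_vec_row k hT.
have h k : carry T (fun j => Y j + Y' j) k =
    (fun j => carry T Y k j + carry (ins T Y) Y' k j) /\
    concat_row (carry T Y k) (carry (ins T Y) Y' k).
  elim: k => [//|k [IH1 IH2]] /=.
  by rewrite IH1 bump_vecD//; split=> //; exact: concat_row_bump.
apply/funext => j; apply/funext => k.
by have [e c] := h k; rewrite /ins e rins_vecD.
Qed.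

End RowVectors.

(** * Concatenation and unique factorization of timed words *)

Section Words.
Context {R : realType} {N : nat}.
Implicit Types (u v w : tword R N) (s : seq (tword R N)).

(** The domain condition of [timed_word] alone: it suffices for extensionality and the monoid laws,
    with no continuity to carry along. *)
Definition total_word w := 0 <= tlen w /\ forall t, tval w t <> None <-> 0 <= t < tlen w.

Lemma tword_eq u v : tlen u = tlen v -> tval u =1 tval v -> u = v.
Proof. by case: u v => [a f] [b g] /= -> /funext ->. Qed.

Lemma total_word_None w t : total_word w -> ~~ (0 <= t < tlen w) -> tval w t = None.
Proof. by move=> [_ h] /negP hn; apply: contrapT => /h. Qed.

Lemma total_word_Some w t : total_word w -> 0 <= t < tlen w ->
  exists a, tval w t = Some a.
Proof. by move=> [_ h] /h; case: (tval w t) => // a _; exists a. Qed.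

Lemma total_word_eq u v : total_word u -> total_word v -> tlen u = tlen v ->
  (forall t, 0 <= t < tlen u -> tval u t = tval v t) -> u = v.
Proof.
move=> hu hv e h; apply: tword_eq => // t.
have [/h//|ht] := boolP (0 <= t < tlen u).
by rewrite !total_word_None// -e.
Qed.

Lemma total_tempty : total_word (@tempty R N).
Proof.
split=> //= t; split=> // /andP[h1 h2].
by have := le_lt_trans h1 h2; rewrite ltxx.
Qed.

Lemma total_tpow (c : 'I_N) (t : R) : 0 <= t -> total_word (tpow c t).
Proof. by move=> t0; split=> //= r; case: ifP. Qed.

Lemma total_tcat u v : total_word u -> total_word v -> total_word (tcat u v).
Proof.
move=> [u0 hu] [v0 hv]; split=> [|t] /=; first exact: addr_ge0.
case: ltP => ht.
  by rewrite hu ht; split=> [/andP[->]//|/andP[->//]]; rewrite ltr_wpDr.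
by rewrite hv; split=> /andP[h1 h2]; apply/andP; split; lra.
Qed.

Lemma tpow0 (c : 'I_N) : tpow c (0 : R) = tempty.
Proof.
apply: tword_eq => //= t; case: ifP => // /andP[h1 h2].
by have := le_lt_trans h1 h2; rewrite ltxx.
Qed.

Lemma tcat0w w : total_word w -> tcat tempty w = w.
Proof.
move=> hw; apply: tword_eq => [|t] /=; first by rewrite add0r.
rewrite subr0; case: ltP => // ht.
by rewrite total_word_None//; apply/negP => /andP[]; lra.
Qed.

Lemma tcatw0 w : total_word w -> tcat w tempty = w.
Proof.
move=> hw; apply: tword_eq => [|t] /=; first by rewrite addr0.
by case: ltP => // ht; rewrite total_word_None//; apply/negP => /andP[]; lra.
Qed.

Lemma tcatA u v w : 0 <= tlen v -> tcat u (tcat v w) = tcat (tcat u v) w.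
Proof.
move=> hv; apply: tword_eq => [|t] /=; first by rewrite addrA.
case: (ltP t (tlen u)) => h1; case: (ltP t (tlen u + tlen v)) => h2 //.
- by exfalso; lra.
- by rewrite ifT//; lra.
- by rewrite ifF; [congr tval; lra | apply/negbTE; rewrite -leNgt; lra].
Qed.

Lemma tcat_injr u v v' : total_word v -> total_word v' -> tcat u v = tcat u v' -> v = v'.
Proof.
move=> hv hv' e.
have el : tlen v = tlen v' by have /= := congr1 (@tlen R N) e; lra.
apply: total_word_eq => // t /andP[t0 _].
have := congr1 (fun w => tval w (tlen u + t)) e => /=.
by rewrite ltNge lerDl t0 /=; have -> : tlen u + t - tlen u = t by lra.
Qed.

Lemma total_tconcat s : (forall u, u \in s -> total_word u) -> total_word (tconcat s).
Proof.
elim: s => [_|u s IH h]; first exact: total_tempty.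
by apply: total_tcat; [|apply: IH => v hv]; apply: h; rewrite inE ?eqxx ?hv ?orbT.
Qed.

Lemma tconcat_cat s s' : (forall u, u \in s ++ s' -> total_word u) ->
  tconcat (s ++ s') = tcat (tconcat s) (tconcat s').
Proof.
elim: s => [|u s IH] h /=; first by rewrite tcat0w//; exact: total_tconcat.
have h' v : v \in s ++ s' -> total_word v by move=> hv; apply: h; rewrite inE hv orbT.
rewrite IH// tcatA//; apply: (proj1 (total_tconcat _)) => v hv.
by apply: h'; rewrite mem_cat hv.
Qed.

Lemma tconcat_rcons s u : (forall v, v \in rcons s u -> total_word v) ->
  tconcat (rcons s u) = tcat (tconcat s) u.
Proof.
move=> h; rewrite -cats1 tconcat_cat /=; last by rewrite cats1.
by rewrite tcatw0//; apply: h; rewrite mem_rcons inE eqxx.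
Qed.

Definition adjacent (bad : tword R N -> tword R N -> Prop) s :=
  forall i, (i.+1 < size s)%N -> bad (nth tempty s i) (nth tempty s i.+1).

Lemma adjacent_cons bad u s : adjacent bad (u :: s) -> adjacent bad s.
Proof. by move=> h i hi; apply: (h i.+1). Qed.

(* A word has at most one factorization into blocks if no block properly
   extends another block u by the first letter of a successor of u. *)
Section UniqueBlocks.
Variables (block : tword R N -> Prop) (bad : tword R N -> tword R N -> Prop).
Hypothesis block_total : forall u, block u -> total_word u /\ 0 < tlen u.
Hypothesis block_maximal : forall u v u', block u -> block v -> block u' ->
  bad u v -> tlen u < tlen u' ->
  (forall t, 0 <= t < tlen u -> tval u' t = tval u t) ->
  tval u' (tlen u) = tval v 0 -> False.

Let blocks s := forall u, u \in s -> block u.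

Let blocks_cons u s : blocks (u :: s) -> block u /\ blocks s.
Proof. by move=> h; split=> [|v hv]; apply: h; rewrite inE ?eqxx ?hv ?orbT. Qed.

Let total_blocks s : blocks s -> total_word (tconcat s).
Proof. by move=> h; apply: total_tconcat => u /h /block_total[]. Qed.

(** A longer [u'] would agree with [u] and go on with the first letter of the block after [u],
    against maximality; if [u] is the last block, the total lengths already disagree. *)
Let block_first u u' s s' : blocks (u :: s) -> blocks (u' :: s') ->
  adjacent bad (u :: s) -> tconcat (u :: s) = tconcat (u' :: s') ->
  tlen u' <= tlen u.
Proof.
move=> /blocks_cons[bu bs] /blocks_cons[bu' bs'] adj e; rewrite leNgt; apply/negP => lt.
have [_ u0] := block_total bu.
case: s bs adj e => [|v s] bs adj e.
  have /= := congr1 (@tlen R N) e; have [] := total_blocks bs'; lra.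
have [bv bs2] := blocks_cons bs.
have [_ v0] := block_total bv.
apply: (block_maximal bu bv bu' (adj 0%N isT) lt) => [t /andP[t0 tu]|].
  have /= := congr1 (fun w => tval w t) e.
  by rewrite tu (lt_trans tu lt).
by have /= := congr1 (fun w => tval w (tlen u)) e; rewrite ltxx lt subrr v0.
Qed.

Lemma tconcat_blocks_inj s s' : blocks s -> blocks s' ->
  adjacent bad s -> adjacent bad s' -> tconcat s = tconcat s' -> s = s'.
Proof.
elim: s s' => [|u s IH] [|u' s'] // bs bs' adj adj' e.
- have [bu bs2] := blocks_cons bs'; have [_ u0] := block_total bu.
  exfalso; have /= := congr1 (@tlen R N) e; have [] := total_blocks bs2; lra.
- have [bu bs2] := blocks_cons bs; have [_ u0] := block_total bu.
  exfalso; have /= := congr1 (@tlen R N) e; have [] := total_blocks bs2; lra.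
have el : tlen u = tlen u'.
  apply/eqP; rewrite eq_le (block_first bs' bs adj' (esym e)).
  by rewrite (block_first bs bs' adj e).
have [bu bs2] := blocks_cons bs; have [bu' bs2'] := blocks_cons bs'.
have eu : u = u'.
  apply: total_word_eq => //; [exact: (block_total bu).1|exact: (block_total bu').1|].
  move=> t /andP[_ tu]; have /= := congr1 (fun w => tval w t) e.
  by rewrite tu -el tu.
congr (_ :: _) => //; apply: IH => //.
- exact: adjacent_cons adj.
- exact: adjacent_cons adj'.
by move: e; rewrite /= eu; apply: tcat_injr; exact: total_blocks.
Qed.

End UniqueBlocks.

End Words.

(** * Timed rows as cumulative vectors *)

Section Rows.
Context {R : realType} {N : nat}.
Implicit Types (X Y : nat -> R) (c : 'I_N).

Definition rw X : tword R N :=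
  TWord (X N) (fun t => [pick j : 'I_N | X j <= t < X j.+1]).

Lemma rw_val X t j : row_vec N X ->
  tval (rw X) t = Some j <-> X j <= t < X j.+1.
Proof.
move=> hX /=; split; first by case: pickP => // i hi [<-].
move=> hj; case: pickP => [i hi|/(_ j)]; last by rewrite hj.
congr Some; apply: val_inj => /=.
have aux (a b : nat) : X a <= t < X a.+1 -> X b <= t < X b.+1 -> (a <= b)%N.
  move=> /andP[h1 _] /andP[_ h2]; rewrite leqNgt; apply/negP => lt.
  by have := row_vec_homo hX lt; lra.
by apply/eqP; rewrite eqn_leq !aux.
Qed.

Lemma rw_total X : row_vec N X -> total_word (rw X).
Proof.
move=> hX; split=> [|t]; first exact: row_vec_ge0 hX _.
split.
  case e: (tval (rw X) t) => [j|//] _.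
  have /andP[h1 h2] := (rw_val t j hX).1 e.
  apply/andP; split; first exact: le_trans (row_vec_ge0 hX _) h1.
  by apply: lt_le_trans h2 _; exact: row_vec_leN.
move=> /andP[t0 tN].
have ex : exists j, t < X j by exists N.
case: (ex_minnP ex) => -[|j] hj hmin.
  by move: hj; case: hX => -> _ _; rewrite ltNge t0.
have jN : (j < N)%N by apply: hmin.
have -> // : tval (rw X) t = Some (Ordinal jN).
apply/rw_val => //=; rewrite hj andbT leNgt; apply/negP => /hmin.
by rewrite ltnn.
Qed.

Lemma tword_eqP (u v : tword R N) : tlen u = tlen v ->
  (forall t j, tval u t = Some j <-> tval v t = Some j) -> u = v.
Proof.
move=> e h; apply: tword_eq => // t.
case eu: (tval u t) => [j|]; first by rewrite (h t j).1.
by case ev: (tval v t) => [j|//]; rewrite (h t j).2 in eu.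
Qed.

Lemma rw0 : rw (fun=> 0) = tempty.
Proof.
apply: tword_eq => //= t; case: pickP => // j /andP[h1 h2].
by have := le_lt_trans h1 h2; rewrite ltxx.
Qed.

Lemma rw_inj X Y : row_vec N X -> row_vec N Y -> rw X = rw Y -> X = Y.
Proof.
move=> hX hY e.
have eN : X N = Y N := congr1 (@tlen R N) e.
(* If [B j < A j], then at position [B j] the row of [A] shows a letter below [j] and the row of [B]
   a letter at least [j]. *)
have aux (A B : nat -> R) : row_vec N A -> row_vec N B -> A N = B N -> rw A = rw B ->
    forall j, A j <= B j.
  move=> hA hB eAB erw j; rewrite leNgt; apply/negP => lt.
  have hBA : B j < B N by apply: (lt_le_trans lt); rewrite -eAB row_vec_leN.
  have [i hi] : exists i, tval (rw B) (B j) = Some i.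
    by apply: total_word_Some; [exact: rw_total|rewrite (row_vec_ge0 hB)].
  have hi' := hi; rewrite -erw in hi'.
  have /andP[_ h1] := (rw_val _ _ hB).1 hi.
  have /andP[h2 _] := (rw_val _ _ hA).1 hi'.
  have [ji|ij] := leqP j i.
    by have := row_vec_homo hA ji; lra.
  by have := row_vec_homo hB ij; lra.
by apply/funext => j; apply/eqP; rewrite eq_le !aux.
Qed.

Lemma rw_cat X Y : row_vec N X -> row_vec N Y -> concat_row N X Y ->
  tcat (rw X) (rw Y) = rw (fun j => X j + Y j).
Proof.
move=> hX hY hXY; apply: tword_eqP => // t j.
have hD := row_vecD hX hY.
have Yj := row_vec_ge0 hY j; have Yj1 := row_vec_ge0 hY j.+1.
have Xj := row_vec_leN hX j; have Xj1 := row_vec_leN hX j.+1.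
have := hXY j; have := hXY j.+1.
rewrite (rw_val _ _ hD) [tval (tcat _ _) t]/=; case: ltP => ht.
  rewrite -[[pick j0 | _]]/(tval (rw X) t) (rw_val _ _ hX).
  by move=> [e1|e1] [e2|e2]; split=> /andP[h1 h2]; apply/andP; split; lra.
rewrite -[[pick j0 | _]]/(tval (rw Y) (t - X N)) (rw_val _ _ hY).
by move=> [e1|e1] [e2|e2]; split=> /andP[h1 h2]; apply/andP; split; lra.
Qed.

Definition letter_vec (c : nat) (t : R) (j : nat) : R := if (c < j)%N then t else 0.

Lemma row_vec_letter c t : 0 <= t -> row_vec N (letter_vec c t).
Proof.
move=> t0; split=> // j; rewrite /letter_vec.
  by case: ltnP => hj; [rewrite ltnS ltnW|case: ifP].
by move=> hj; rewrite !ifT//; case: c => c /= hc; lia.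
Qed.

Lemma rw_letter c t : 0 <= t -> rw (letter_vec c t) = tpow c t.
Proof.
move=> t0; have hc := row_vec_letter c t0; apply: tword_eqP => [|r j].
  by rewrite /= /letter_vec ltn_ord.
rewrite rw_val// /letter_vec /=; split.
  case: ltngtP => [cj|jc|/val_inj <-].
  - by rewrite ltnS ltnW// => /andP[h1 h2]; exfalso; lra.
  - by rewrite ifF; [move=> /andP[h1 h2]; exfalso; lra|lia].
  - by rewrite ltnSn => ->.
by case: ifP => // h [<-]; rewrite ltnn ltnSn.
Qed.

Lemma rins_vec_letter X c t j : row_vec N X -> 0 <= t ->
  rins_vec X (letter_vec c t) j =
  if (j <= c)%N then X j else Num.max (X c.+1 + t) (X j).
Proof.
move=> [X0 hX XN] t0; elim: j => [|j IH] /=; first by rewrite X0.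
rewrite IH /letter_vec; case: (ltngtP j c) => h.
- by rewrite ltnS leqNgt h /= subrr addr0 max_r.
- by rewrite ltnS (ltnW h) subrr addr0 -maxA [Num.max (X j) _]max_r.
- by rewrite h ltnSn max_r ?hX// max_l ?subr0// lerDl.
Qed.

Lemma tsub_rw X a b : row_vec N X -> 0 <= a -> a <= b -> b <= X N ->
  let C := fun j => Num.min (Num.max (X j) a) b - a in
  row_vec N C /\ tsub (rw X) a b = rw C.
Proof.
move=> hX a0 ab bN C.
have hC : row_vec N C.
  case: hX => X0 hX XN; rewrite /C; split.
  - by rewrite X0 max_r// min_l// subrr.
  - move=> j; set p := Num.max (X j) a; set q := Num.max (X j.+1) a.
    have pq : p <= q by rewrite /p ge_max !le_max hX lexx orbT.
    by case: (leP p b); case: (leP q b) => *; lra.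
  - by move=> j hj; rewrite XN.
split=> //; apply: tword_eqP => [|t j].
  by rewrite /= /C max_l ?min_r//; exact: le_trans bN.
have hle x t' : 0 <= t' < b - a ->
    (Num.min (Num.max x a) b - a <= t') = (x <= a + t').
  move=> /andP[t0 tb]; rewrite lerBlDl ge_min ge_max lerDl t0 andbT.
  by rewrite [b <= _]leNgt -ltrBrDl tb orbF.
rewrite (rw_val _ _ hC) [tval (tsub _ _ _) t]/=.
rewrite -[[pick j0 | _]]/(tval (rw X) (a + t)) /C.
case: ifP => [ht|h].
  by rewrite rw_val// hle// ltNge [(t < _ - _)]ltNge hle.
split=> // /andP[h1 h2]; exfalso; move/negP: h; apply; apply/andP; split.
  by apply: le_trans h1; rewrite subr_ge0 le_min le_max lexx orbT.
by apply: (lt_le_trans h2); rewrite lerD2r ge_min lexx orbT.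
Qed.

Lemma rins1_rw X c t : row_vec N X -> 0 <= t ->
  rins1 (rw X) c t =
  (rw (bump_vec X (letter_vec c t)), rw (rins_vec X (letter_vec c t))).
Proof.
move=> hX t0; have [X0 hX' XN] := hX; have hc := row_vec_letter c t0.
have bumpE j : bump_vec X (letter_vec c t) j =
    if (j <= c)%N then 0 else Num.min (X j - X c.+1) t.
  rewrite /bump_vec rins_vec_letter// /letter_vec; case: leqP => h.
    by rewrite addr0 subrr.
  by case: leP => h1; case: leP => h2; lra.
have rinsE j := rins_vec_letter c j hX t0.
have cN := row_vec_leN hX c.+1; have c0 := row_vec_ge0 hX c.+1.
rewrite /rins1; case: asboolP => [hall|hnot].
  have Xc : X c.+1 = X N.
    apply/eqP; rewrite eq_le cN /= leNgt; apply/negP => lt.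
    have [d hd] : exists d, tval (rw X) (X c.+1) = Some d.
      by apply: total_word_Some; [exact: rw_total|rewrite c0].
    have dc := hall _ _ hd; have /andP[_ h] := (rw_val _ _ hX).1 hd.
    by have := row_vec_homo hX (dc : d.+1 <= c.+1)%N; lra.
  have XcE j : (c < j)%N -> X j = X N.
    move=> h; apply/eqP; rewrite eq_le (row_vec_leN hX) -Xc.
    by rewrite (row_vec_homo hX).
  congr pair.
    rewrite -rw0; congr rw; apply/funext => j; rewrite bumpE.
    by case: leqP => // h; rewrite XcE// Xc subrr min_l.
  rewrite -rw_letter// rw_cat//.
    congr rw; apply/funext => j; rewrite rinsE /letter_vec; case: leqP => h.
      by rewrite addr0.
    by rewrite XcE// Xc max_l// lerDl.
  by move=> j; rewrite /letter_vec; case: ltnP => h; [left; rewrite XcE|right].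
have lt : X c.+1 < X N.
  rewrite ltNge; apply/negP => le; apply: hnot => r d /(rw_val _ _ hX) /andP[h1 h2].
  rewrite leqNgt; apply/negP => cd; have := row_vec_homo hX cd.
  by have := row_vec_leN hX d.+1; lra.
(* The letters above [c] occupy [[X c.+1, X N)], so the cut point of [rins1] is [X c.+1]. *)
have -> : [set r | exists2 d, tval (rw X) r = Some d & (c < d)%N] =
    `[X c.+1, X N[%classic.
  apply/seteqP; split=> r /=; rewrite in_itv /=.
    move=> [d /(rw_val _ _ hX) /andP[h1 h2] cd]; apply/andP; split.
      exact: le_trans (row_vec_homo hX cd) h1.
    by apply: lt_le_trans h2 _; exact: row_vec_leN.
  move=> /andP[h1 h2].
  have [d hd] : exists d, tval (rw X) r = Some d.
    by apply: total_word_Some; [exact: rw_total|rewrite (le_trans c0 h1)].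
  exists d => //; rewrite ltnNge; apply/negP => dc.
  have /andP[_ h] := (rw_val _ _ hX).1 hd.
  by have := row_vec_homo hX (dc : d.+1 <= c.+1)%N; lra.
rewrite inf_itv; last by rewrite bnd_simp.
have [hA eA] := tsub_rw hX (lexx 0) c0 cN.
set A := fun j => _ in hA eA.
have AE j : A j = Num.min (X j) (X c.+1).
  by rewrite /A max_l ?subr0// (row_vec_ge0 hX).
have Ac j : (c < j)%N -> A j = X c.+1.
  by move=> h; rewrite AE min_r// (row_vec_homo hX).
have Al j : (j <= c)%N -> A j = X j.
  by move=> h; rewrite AE min_l// (row_vec_homo hX)// leqW.
have cA : concat_row N A (letter_vec c t).
  move=> j; rewrite /letter_vec; case: ltnP => h; last by right.
  by left; rewrite Ac// Ac.
rewrite eA -rw_letter// rw_cat//.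
have -> : tlen (rw X) = X N by [].
case: ltP => ht.
  have tN : X c.+1 + t <= X N by lra.
  have ct : X c.+1 <= X c.+1 + t by rewrite lerDl.
  have [hB eB] := tsub_rw hX c0 ct tN.
  rewrite eB.
  have [hD eD] := tsub_rw hX (addr_ge0 c0 t0) tN (lexx _).
  rewrite eD rw_cat//; [|exact: row_vecD|]; last first.
  - move=> j; have [h|h] := leP (X j) (X c.+1 + t).
      by right; rewrite min_l ?subrr.
    have cj : (c < j)%N.
      rewrite ltnNge; apply/negP => jc.
      by have := row_vec_homo hX (leqW jc : j <= c.+1)%N; lra.
    by left; rewrite /letter_vec cj Ac// ltn_ord Ac.
  congr (rw _, rw _); apply/funext => j.
    rewrite bumpE; case: leqP => h.
      have := row_vec_homo hX (leqW h : j <= c.+1)%N => hj.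
      by rewrite max_r// min_l ?subrr// lerDl.
    rewrite max_l ?(row_vec_homo hX)//.
    by case: leP => h1; case: leP => h2; lra.
  rewrite rinsE /letter_vec; case: leqP => h.
    have := row_vec_homo hX (leqW h : j <= c.+1)%N => hj.
    by rewrite Al// max_r ?min_l//; lra.
  rewrite Ac// min_l; last by rewrite ge_max (row_vec_leN hX).
  by rewrite maxC; ring.
have [hB eB] := tsub_rw hX c0 cN (lexx _).
rewrite eB; congr (rw _, rw _); apply/funext => j.
  rewrite bumpE; have hj := row_vec_leN hX j; case: leqP => h.
    have := row_vec_homo hX (leqW h : j <= c.+1)%N => hj'.
    by rewrite max_r// min_l ?subrr.
  by rewrite max_l ?(row_vec_homo hX)// !min_l//; lra.
have hj := row_vec_leN hX j.
rewrite rinsE /letter_vec; case: leqP => h; first by rewrite Al// addr0.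
by rewrite Ac// max_l//; lra.
Qed.

End Rows.

(** * Row and tableau insertion of timed words *)

Section Insertion.
Context {R : realType} {N : nat}.
Implicit Types (X Y : nat -> R) (T : nat -> nat -> R) (c : 'I_N).

Lemma texp_total (s : seq ('I_N * R)) : (forall ct, ct \in s -> 0 <= ct.2) ->
  total_word (texp s).
Proof.
move=> h; apply: total_tconcat => u /mapP[ct /h h0 ->]; exact: total_tpow.
Qed.

Lemma texp_cat (s s' : seq ('I_N * R)) : (forall ct, ct \in s ++ s' -> 0 <= ct.2) ->
  texp (s ++ s') = tcat (texp s) (texp s').
Proof.
move=> h; rewrite /texp map_cat tconcat_cat// => u.
rewrite -map_cat => /mapP[ct /h h0 ->].
exact: total_tpow.
Qed.

Lemma texp_filter (s : seq ('I_N * R)) : (forall ct, ct \in s -> 0 <= ct.2) ->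
  texp [seq ct <- s | 0 < ct.2] = texp s.
Proof.
elim: s => [//|[c t] s IH] h.
have hs ct : ct \in s -> 0 <= ct.2 by move=> hct; apply: h; rewrite inE hct orbT.
have t0 : 0 <= t by apply: (h (c, t)); rewrite inE eqxx.
rewrite /=; case: ltP => ht /=; first by rewrite /texp /= -!/(texp _) IH.
rewrite IH// /texp /= -/(texp _).
have -> : t = 0 by apply/eqP; rewrite eq_le ht t0.
by rewrite tpow0 tcat0w//; exact: texp_total.
Qed.

Lemma tpow_inj (ct dt : 'I_N * R) : 0 < ct.2 ->
  tpow ct.1 ct.2 = tpow dt.1 dt.2 -> ct = dt.
Proof.
case: ct dt => [c t] [d r] /= t0 e.
have et : t = r := congr1 (@tlen R N) e.
have /= := congr1 (fun w => tval w 0) e; rewrite -et lexx t0 /= => -[->].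
by [].
Qed.

Lemma texp_reduced_inj (s s' : seq ('I_N * R)) :
  reduced s -> reduced s' -> texp s = texp s' -> s = s'.
Proof.
move=> /andP[/allP p1 r1] /andP[/allP p2 r2] e.
have : [seq tpow ct.1 ct.2 | ct <- s] = [seq tpow ct.1 ct.2 | ct <- s'].
  (* Unique factorization with powers of a letter as blocks: a longer power of [c] cannot continue
     with a letter other than [c]. *)
  pose block (u : tword R N) := exists c t, 0 < t /\ u = tpow c t.
  pose bad (u v : tword R N) := exists c t d r, c != d /\ u = tpow c t /\ v = tpow d r.
  have hadj (l : seq ('I_N * R)) : sorted (fun ct ct' => ct.1 != ct'.1) l ->
      adjacent bad [seq tpow ct.1 ct.2 | ct <- l].
    case: l => [//|x l] hl i; rewrite size_map => hi.
    move/(sortedP x) : hl => /(_ i hi) hne.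
    rewrite !(nth_map x)//; last exact: ltnW.
    by exists (nth x (x :: l) i).1, (nth x (x :: l) i).2, (nth x (x :: l) i.+1).1,
      (nth x (x :: l) i.+1).2.
  have hbl (l : seq ('I_N * R)) : {in l, forall ct, 0 < ct.2} ->
      forall u, u \in [seq tpow ct.1 ct.2 | ct <- l] -> block u.
    by move=> hl u /mapP[ct /hl h ->]; exists ct.1, ct.2.
  apply: (@tconcat_blocks_inj _ _ block bad) => //; try exact: hbl; try exact: hadj.
  - by move=> u [c [t [t0 ->]]]; split=> //; apply: total_tpow; exact: ltW.
  - move=> u v u' [c [t [t0 ->]]] [d [r [r0 ->]]] [c' [t' [t'0 ->]]].
    move=> [c1 [t1 [d1 [r1' [ne [e1 e2]]]]]] /= lt h1.
    have [h2 _] : (c, t) = (c1, t1) by exact: tpow_inj.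
    have [h3 _] : (d, r) = (d1, r1') by exact: tpow_inj.
    have := h1 0; rewrite lexx t0 t'0 => /(_ isT) [ec].
    rewrite (ltW t0) lt r0 /= => -[ed].
    by move: ne; rewrite -h2 -h3 -ec ed eqxx.
elim: s s' p1 p2 {r1 r2 e} => [|ct s IH] [|dt s'] // p1 p2 e.
have /= e1 := congr1 (head tempty) e; have /= es := congr1 behead e.
congr (_ :: _); first by apply: tpow_inj e1; apply: p1; rewrite inE eqxx.
by apply: IH => // x hx; [apply: p1|apply: p2]; rewrite inE hx orbT.
Qed.

Lemma texpr_texp (s : seq ('I_N * R)) : reduced s -> texpr (texp s) = s.
Proof.
move=> hs; apply: xget_unique => //= s' [hs' /esym e].
exact/esym/texp_reduced_inj.
Qed.

Definition row_expr Y : seq ('I_N * R) := [seq (j, Y j.+1 - Y j) | j : 'I_N <- enum 'I_N].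

(** The letters below [k] of a row: [rins] reads its row one letter at a time, and the inductions
    run over these prefixes. *)
Definition trunc k Y (j : nat) : R := Y (minn k j).

Lemma row_vec_trunc k Y : row_vec N Y -> row_vec N (trunc k Y).
Proof.
move=> hY; have [Y0 hY' YN] := hY; split; rewrite /trunc; first by rewrite minn0.
  by move=> j; apply: row_vec_homo hY _ _ _; lia.
by move=> j hj; have [kN|Nk] := leqP k N; [congr Y; lia|rewrite YN; [congr Y|]; lia].
Qed.

Lemma truncS Y (k : 'I_N) :
  trunc k.+1 Y = fun j => trunc k Y j + letter_vec k (Y k.+1 - Y k) j.
Proof.
apply/funext => j; rewrite /trunc /letter_vec; case: ltnP => h.
  have -> : minn k.+1 j = k.+1 by lia.
  by ring.
have -> : minn k.+1 j = j by lia.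
by rewrite addr0.
Qed.

Lemma concat_row_truncS Y (k : 'I_N) :
  concat_row N (trunc k Y) (letter_vec k (Y k.+1 - Y k)).
Proof.
move=> j; rewrite /letter_vec /trunc; case: ltnP => h; last by right.
by left; congr Y; have := ltn_ord k; lia.
Qed.

Lemma take_enumS k (kN : (k < N)%N) :
  take k.+1 (enum 'I_N) = rcons (take k (enum 'I_N)) (Ordinal kN).
Proof.
rewrite (take_nth (Ordinal kN)) ?size_enum_ord//; congr rcons.
by apply: val_inj; rewrite /= nth_enum_ord.
Qed.

Lemma row_expr_ge0 Y : row_vec N Y -> forall ct, ct \in row_expr Y -> 0 <= ct.2.
Proof. by move=> [_ hY _] ct /mapP[j _ ->] /=; rewrite subr_ge0. Qed.

Lemma trunc_rw Y : row_vec N Y -> rw (N := N) (trunc N Y) = rw Y.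
Proof.
move=> [_ _ YN]; congr rw; apply/funext => j; rewrite /trunc.
by case: leqP => // h; rewrite YN.
Qed.

Lemma trunc0 Y : row_vec N Y -> trunc 0 Y = fun=> 0.
Proof. by move=> [Y0 _ _]; apply/funext => j; rewrite /trunc min0n. Qed.

Lemma texp_row_expr Y : row_vec N Y -> texp (row_expr Y) = rw Y.
Proof.
move=> hY; have [_ hYS _] := hY.
suff h k : (k <= N)%N ->
    texp [seq (j, Y j.+1 - Y j) | j : 'I_N <- take k (enum 'I_N)] = rw (trunc k Y).
  by rewrite -trunc_rw// -h// take_oversize// size_enum_ord.
elim: k => [_|k IH kN]; first by rewrite take0 trunc0// rw0.
rewrite take_enumS map_rcons -cats1 texp_cat; last first.
  by move=> ct; rewrite cats1 -map_rcons => /mapP[j _ ->] /=; rewrite subr_ge0.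
rewrite IH ?(ltnW kN)// (truncS Y (Ordinal kN)).
have d0 : 0 <= Y k.+1 - Y k by rewrite subr_ge0.
rewrite -rw_cat; [|exact: row_vec_trunc|exact: row_vec_letter|exact: concat_row_truncS].
by rewrite rw_letter// /texp /= tcatw0//; exact: total_tpow.
Qed.

Lemma texpr_rw Y : row_vec N Y -> texpr (rw Y) = [seq ct <- row_expr Y | 0 < ct.2].
Proof.
move=> hY; rewrite -texp_row_expr// -texp_filter; last exact: row_expr_ge0.
apply: texpr_texp; rewrite /reduced filter_all /=.
apply: (@sub_sorted _ (fun ct ct' : 'I_N * R => (ct.1 < ct'.1)%N)).
  by move=> x y; rewrite ltn_neqAle => /andP[].
apply: sorted_filter; first by move=> x y z; exact: ltn_trans.
rewrite sorted_map; have := iota_ltn_sorted 0 N; rewrite -val_enum_ord sorted_map.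
exact.
Qed.

(** Each new letter of [Y] concatenates with the prefix already inserted to a row, so additivity
    extends the one-letter case [rins1_rw] to whole rows. *)
Lemma rins_rw X Y : row_vec N X -> row_vec N Y ->
  rins (rw X) (rw Y) = (rw (N := N) (bump_vec X Y), rw (rins_vec X Y)).
Proof.
move=> hX hY; have [_ hYS _] := hY; rewrite /rins texpr_rw// /row_expr.
set f := fun _ _ => _.
suff h k : (k <= N)%N ->
    foldl f (tempty, rw X)
      [seq ct <- [seq (j, Y j.+1 - Y j) | j : 'I_N <- take k (enum 'I_N)] | 0 < ct.2]
    = (rw (N := N) (bump_vec X (trunc k Y)), rw (rins_vec X (trunc k Y))).
  have -> : Y = trunc N Y.
    by apply: (rw_inj hY (row_vec_trunc _ hY)); rewrite trunc_rw.
  rewrite -h//= take_oversize ?size_enum_ord//.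
  rewrite {1 2}(_ : trunc N Y = Y)//.
  by apply: (rw_inj (row_vec_trunc _ hY) hY); rewrite trunc_rw.
elim: k => [_|k IH kN].
  rewrite take0 /= trunc0// (rins_vecX0 hX).
  congr (_, _); rewrite -rw0; congr rw; apply/funext => j.
  by rewrite /bump_vec (rins_vecX0 hX) addr0 subrr.
rewrite take_enumS map_rcons filter_rcons /=.
have hk := row_vec_trunc k hY.
have d0 : 0 <= Y k.+1 - Y k by rewrite subr_ge0.
rewrite (truncS Y (Ordinal kN)) /=.
have hc := concat_row_truncS Y (Ordinal kN).
have hl := row_vec_letter (Ordinal kN) d0.
have hR := row_vec_rins hX hk.
rewrite (rins_vecD hX hk hl hc) (bump_vecD hX hk hl hc).
rewrite -rw_cat; [|exact: row_vec_bump|exact: row_vec_bump|exact: concat_row_bump].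
have hst := rins1_rw (Ordinal kN) hR d0.
have [dp|dn] := ltP 0 (Y k.+1 - Y k).
  by rewrite foldl_rcons IH ?(ltnW kN)// /f /= hst.
(* A zero exponent was filtered out of the expression; its vector is zero and changes nothing. *)
rewrite IH ?(ltnW kN)//.
have -> : letter_vec k (Y k.+1 - Y k) = fun=> 0.
  apply/funext => j; rewrite /letter_vec; case: ifP => // _.
  by apply/eqP; rewrite eq_le dn d0.
have -> : bump_vec (rins_vec X (trunc k Y)) (fun=> 0) = fun=> 0.
  by apply/funext => j; rewrite /bump_vec (rins_vecX0 hR) addr0 subrr.
rewrite (rins_vecX0 hR) rw0 tcatw0//.
by apply: rw_total; exact: row_vec_bump.
Qed.

(** Padded with empty rows to exactly [N] rows, so that the number of nonempty rows, which insertion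
    may change, does not enter. *)
Definition tab_word T : tword R N := tconcat (rev [seq rw (T^~ k) | k <- iota 0 N]).

Lemma insert_rows_rw T Y : tab_vec N T -> row_vec N Y ->
  forall r s,
  insert_rows [seq rw (T^~ k) | k <- iota s r] (rw (carry T Y s)) =
  tconcat (rw (carry T Y (s + r)) ::
           rev [seq rw ((ins T Y)^~ k) | k <- iota s r] : seq (tword R N)).
Proof.
move=> hT hY; elim=> [|r IH] s.
  by rewrite /= tcatw0 ?addn0//; apply: rw_total; exact: row_vec_carry.
have hI := tab_vec_ins hT hY.
rewrite [LHS]/= rins_rw; [|exact: tab_vec_row|exact: row_vec_carry].
rewrite [LHS]/= -/(carry T Y s.+1) IH addSnnS map_cons rev_cons.
rewrite -rcons_cons tconcat_rcons//.
move=> v; rewrite mem_rcons !inE => /or3P[/eqP->|/eqP->|].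
- by apply: rw_total; apply: (@tab_vec_row _ N (ins T Y) s).
- by apply: rw_total; exact: row_vec_carry.
- by rewrite mem_rev => /mapP[k _ ->]; apply: rw_total; exact: tab_vec_row.
Qed.

(** [insert_rows] stops after [p] rows and leaves the last bumped row as a new row. Sending it on
    through the empty rows up to [N] gives the same word, since an empty row keeps all it receives
    and bumps nothing. *)
Lemma insert_rows_prefix T Y p : tab_vec N T -> row_vec N Y -> (p <= N)%N ->
  (forall k, (p <= k)%N -> T^~ k = fun=> 0) ->
  insert_rows [seq rw (T^~ k) | k <- iota 0 p] (rw Y) = tab_word (ins T Y).
Proof.
move=> hT hY pN hp; have hI := tab_vec_ins hT hY.
have total_ins k : total_word (rw (N := N) ((ins T Y)^~ k)).
  by apply: rw_total; exact: tab_vec_row.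
have := insert_rows_rw hT hY p 0; rewrite add0n /= => ->.
pose E r := tconcat (rw (carry T Y r) ::
  rev [seq rw ((ins T Y)^~ k) | k <- iota 0 r] : seq (tword R N)).
have total_E r : total_word (E r).
  apply: total_tconcat => u; rewrite inE => /predU1P[->|].
    by apply: rw_total; exact: row_vec_carry.
  by rewrite mem_rev => /mapP[k _ ->].
have ES r : (p <= r)%N -> E r.+1 = E r.
  move=> pr; have hc := row_vec_carry r hT hY.
  have e1 : (ins T Y)^~ r = carry T Y r.
    by rewrite /ins hp// (rins_vec0Y hc).
  have e2 : carry T Y r.+1 = fun=> 0.
    by apply/funext => j; rewrite /= hp// /bump_vec (rins_vec0Y hc) add0r subrr.
  rewrite /E -addn1 iotaD map_cat rev_cat /= add0n addn1 e1 e2 rw0 tcat0w//.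
  exact: total_E.
have Ee e : E (p + e)%N = E p.
  by elim: e => [|e IH]; rewrite ?addn0// addnS ES// leq_addr.
rewrite -[LHS]/(E p) -(Ee (N - p)%N) subnKC// /E /=.
have -> : carry T Y N = fun=> 0.
  by apply: (@row_vec_eq0 _ N); [exact: row_vec_carry|apply: carry_eq0 hT hY _].
by rewrite rw0 tcat0w//; apply: total_tconcat => u; rewrite mem_rev => /mapP[k _ ->].
Qed.

End Insertion.

(** * Row decompositions of timed words *)

Section RowDecomposition.
Context {R : realType} {N : nat}.
Implicit Types (u v w : tword R N) (X Y : nat -> R) (T : nat -> nat -> R).

Lemma right_continuousP w t : word_right_continuous_at w t <->
  exists2 e, 0 < e & forall s, t < s < t + e -> 0 <= s < tlen w -> tval w s = tval w t.
Proof.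
split=> [/nbhs_ballP[e /= e0 h]|[e e0 h]].
  exists e => // s /andP[ts se] hs; apply: h => //.
  by rewrite /ball /= ltr0_norm; lra.
apply/nbhs_ballP; exists e => // s; rewrite /ball /= => hs ts; apply: h.
by rewrite ts /=; move: hs; rewrite ltr0_norm; lra.
Qed.

Lemma continuousP w t : word_continuous_at w t <->
  exists2 e, 0 < e & forall s, t - e < s < t + e -> 0 <= s < tlen w -> tval w s = tval w t.
Proof.
split=> [/nbhs_ballP[e /= e0 h]|[e e0 h]].
  exists e => // s hs hs'; apply: h => //.
  by rewrite /ball /= distrC ltr_distl.
apply/nbhs_ballP; exists e => // s; rewrite /ball /= => hs; apply: h.
by move: hs; rewrite distrC ltr_distl.
Qed.

Lemma timed_word_total w : timed_word w -> total_word w.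
Proof. by case. Qed.

Lemma timed_tempty : timed_word (@tempty R N).
Proof.
have [h1 h2] := @total_tempty R N; split=> //.
  by move=> t /= /andP[t0 t1]; exfalso; lra.
rewrite (_ : [set _ | _] = set0); first exact: finite_set0.
by apply/seteqP; split=> // t /= [/andP[t0 t1] _]; lra.
Qed.

Lemma timed_tpow (c : 'I_N) (t : R) : 0 <= t -> timed_word (tpow c t).
Proof.
move=> t0; have [h1 h2] := total_tpow c t0.
have h s r : 0 <= s < t -> 0 <= r < t -> tval (tpow c t) s = tval (tpow c t) r.
  by move=> /= -> ->.
split=> //.
  by move=> s hs; apply/right_continuousP; exists 1 => // r _ hr; exact: h.
rewrite (_ : [set _ | _] = set0); first exact: finite_set0.
apply/seteqP; split=> // s /= [hs]; case; apply/continuousP.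
by exists 1 => // r _ hr; exact: h.
Qed.

Lemma timed_tcat u v : timed_word u -> timed_word v -> timed_word (tcat u v).
Proof.
move=> hu hv; have [h1 h2] := total_tcat (timed_word_total hu) (timed_word_total hv).
case: hu hv => [u0 du ru fu] [v0 dv rv fv].
have tu t : t < tlen u -> tval (tcat u v) t = tval u t by move=> /= ->.
have tv t : tlen u <= t -> tval (tcat u v) t = tval v (t - tlen u).
  by move=> /=; rewrite leNgt => /negbTE ->.
split=> //.
  move=> t /andP[t0 tN]; apply/right_continuousP.
  have [lt|ge] := ltP t (tlen u).
    have /right_continuousP[e e0 he] : word_right_continuous_at u t.
      by apply: ru; rewrite t0.
    exists (Num.min e (tlen u - t)); first by rewrite lt_min e0 subr_gt0.
    move=> s /andP[ts]; rewrite -ltrBlDl lt_min => /andP[s1 s2] /andP[s0 _].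
    have su : s < tlen u by lra.
    by rewrite !tu//; apply: he; rewrite ?ts ?s0//=; lra.
  have /right_continuousP[e e0 he] : word_right_continuous_at v (t - tlen u).
    by apply: rv; move: tN => /= ?; apply/andP; split; lra.
  exists e => // s /andP[ts se] /andP[s0 sN]; have su : tlen u <= s by lra.
  rewrite !tv//; apply: he; first by apply/andP; split; lra.
  by move: sN => /= ?; apply/andP; split; lra.
apply: (@sub_finite_set _ _ ([set t | 0 <= t < tlen u /\ ~ word_continuous_at u t] `|`
   ([set tlen u] `|` [set t + tlen u | t in
      [set t | 0 <= t < tlen v /\ ~ word_continuous_at v t]]))); last first.
  by rewrite !finite_setU; split=> //; split; [exact: finite_set1|exact: finite_image].
move=> t [] /andP[t0 tN] nc; have tN' : t < tlen u + tlen v := tN.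
have [lt|gt|eq] := ltgtP t (tlen u); last by right; left.
  left; split=> [|/continuousP[e e0 he]]; first by rewrite t0.
  apply: nc; apply/continuousP; exists (Num.min e (tlen u - t)).
    by rewrite lt_min e0 subr_gt0.
  move=> s /andP[ts]; rewrite -ltrBlDl lt_min => /andP[s1 s2] /andP[s0 _].
  have su : s < tlen u by lra.
  rewrite !tu//; apply: he; rewrite ?s0 ?su//.
  apply/andP; split; last by lra.
  by apply: le_lt_trans ts; rewrite lerD2l lerN2 ge_min lexx.
right; right; exists (t - tlen u); last by rewrite subrK.
split=> [|/continuousP[e e0 he]]; first by apply/andP; split; lra.
apply: nc; apply/continuousP; exists (Num.min e (t - tlen u)).
  by rewrite lt_min e0 subr_gt0.
move=> s /andP[]; rewrite ltrBlDr -ltrBlDl lt_min => /andP[s1 s2] s3 /andP[s0 sN].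
have sN' : s < tlen u + tlen v := sN.
have su : tlen u <= s by lra.
have su' := ltW gt.
rewrite !tv//; apply: he; last by apply/andP; split; lra.
have : Num.min e (t - tlen u) <= e by rewrite ge_min lexx.
by move=> ?; apply/andP; split; lra.
Qed.

Lemma timed_tconcat (s : seq (tword R N)) :
  (forall u, u \in s -> timed_word u) -> timed_word (tconcat s).
Proof.
elim: s => [_|u s IH h]; first exact: timed_tempty.
by apply: timed_tcat; [|apply: IH => v hv]; apply: h; rewrite inE ?eqxx ?hv ?orbT.
Qed.

Lemma timed_row_rw X : row_vec N X -> timed_row (rw (N := N) X).
Proof.
move=> hX; split.
  rewrite -texp_row_expr//; apply: timed_tconcat => u /mapP[ct hct ->].
  by apply: timed_tpow; exact: row_expr_ge0 hct.
move=> s t a b st /(rw_val _ _ hX)/andP[h1 h2] /(rw_val _ _ hX)/andP[h3 h4].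
by rewrite leqNgt; apply/negP => ba; have := row_vec_homo hX ba; lra.
Qed.

Lemma locally_constant w a b : timed_word w -> 0 <= a -> b <= tlen w ->
  (forall t, a < t < b -> word_continuous_at w t) ->
  forall s, a <= s < b -> tval w s = tval w a.
Proof.
move=> [w0 dw rw fw] a0 bN hc s1 hs1; apply: contrapT => ne.
pose S := [set s | a <= s < b /\ tval w s <> tval w a].
have S1 : S s1 by [].
have lbS : lbound S a by move=> s [/andP[]].
have infS : has_inf S by split; [exists s1|exists a].
have S1b : inf S < b.
  by move: hs1 => /andP[_]; apply: le_lt_trans; apply: ge_inf => //; exists a.
have /right_continuousP[e e0 he] : word_right_continuous_at w a.
  by apply: rw; move: hs1 => /andP[h1 h2]; rewrite a0 /=; lra.
have aS : a < inf S.
  suff : a + e <= inf S by lra.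
  apply: lb_le_inf; first by exists s1.
  move=> s [/andP[as_ sb] hs]; rewrite leNgt; apply/negP => lt.
  have [e1|ne1] := eqVneq a s; first by apply: hs; rewrite e1.
  apply: hs; apply: he; first by rewrite lt lt_neqAle ne1 as_.
  by apply/andP; split; lra.
have /continuousP[e' e'0 he'] : word_continuous_at w (inf S) by apply: hc; rewrite aS.
have eqS : tval w (inf S) = tval w a.
  pose s := Num.max a (inf S - e' / 2).
  have sS : s < inf S by rewrite gt_max aS; lra.
  have as_ : a <= s by rewrite le_max lexx.
  have se : inf S - e' < s by rewrite lt_max; apply/orP; right; lra.
  rewrite -(he' s); [|by rewrite se; lra|by apply/andP; split; lra].
  apply: contrapT => hs; have : S s by split=> //; apply/andP; split; lra.
  by move=> /(ge_inf (infS.2)); rewrite leNgt sS.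
have [s2 [/andP[as2 s2b] hs2] s2S] := inf_adherent e'0 infS.
have s2S' : inf S <= s2 by apply: ge_inf; [exists a|split=> //; rewrite as2].
apply: hs2; rewrite -eqS; apply: he'; first by rewrite s2S andbT; lra.
by apply/andP; split; lra.
Qed.

Lemma tsub_cat w a c b : a <= c -> c <= b ->
  tsub w a b = tcat (tsub w a c) (tsub w c b).
Proof.
move=> ac cb; apply: tword_eq => [|t] /=; first by ring.
case: (ltP t (c - a)) => h.
  by case: (ltP t (b - a)) => h2; rewrite ?andbT ?andbF//; exfalso; lra.
have -> : c + (t - (c - a)) = a + t by ring.
have -> : (0 <= t - (c - a)) by lra.
have -> : (0 <= t) by lra.
by have -> : (t - (c - a) < b - c) = (t < b - a) by apply/idP/idP => ?; lra.
Qed.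

Lemma tsub_id w : total_word w -> tsub w 0 (tlen w) = w.
Proof.
move=> hw; apply: tword_eq => [|t] /=; first by rewrite subr0.
rewrite subr0 add0r; case: ifP => // /negbT h; rewrite total_word_None//.
Qed.

Definition all_rows (Ys : seq (nat -> R)) : Prop :=
  foldr (fun Y P => row_vec N Y /\ P) True Ys.

Lemma all_rows_cat Ys Ys' : all_rows Ys -> all_rows Ys' -> all_rows (Ys ++ Ys').
Proof. by elim: Ys => //= Y Ys IH [h1 h2] h3; split=> //; exact: IH. Qed.

Lemma all_rows_mem Ys u : all_rows Ys -> u \in [seq rw (N := N) Y | Y <- Ys] ->
  exists2 Y, row_vec N Y & u = rw Y.
Proof.
elim: Ys => //= Y Ys IH [h1 h2]; rewrite inE => /predU1P[->|]; last exact: IH.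
by exists Y.
Qed.

Lemma all_rows_total Ys u : all_rows Ys -> u \in [seq rw (N := N) Y | Y <- Ys] ->
  total_word u.
Proof. by move=> h /(all_rows_mem h)[Y hY ->]; exact: rw_total. Qed.

Lemma timed_word_rows w : timed_word w ->
  exists2 Ys, all_rows Ys & w = tconcat [seq rw Y | Y <- Ys].
Proof.
move=> hw; have hv := timed_word_total hw.
have base a b : 0 <= a -> a <= b -> b <= tlen w ->
    (forall t, a < t < b -> word_continuous_at w t) ->
    exists2 Ys, all_rows Ys & tsub w a b = tconcat [seq rw Y | Y <- Ys].
  move=> a0; rewrite le_eqVlt => /predU1P[<- _ _|ab bN hc].
    exists [::] => //; apply: tword_eq => [|t] /=; first by rewrite subrr.
    by case: ifP => // /andP[? ?]; exfalso; lra.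
  have [c ec] : exists c, tval w a = Some c.
    by apply: total_word_Some => //; rewrite a0 (lt_le_trans ab).
  have ba : 0 <= b - a by lra.
  exists [:: letter_vec c (b - a)]; first by split=> //; exact: row_vec_letter.
  rewrite /= rw_letter// tcatw0; last exact: total_tpow.
  apply: tword_eq => //= t; case: ifP => // /andP[t0 tb].
  by rewrite (locally_constant hw a0 bN hc)//; apply/andP; split; lra.
(* Induction on a list [D] containing the discontinuities inside [(a, b)]: cutting at one of them
   removes it from the list on both sides. *)
suff h n (D : seq R) : (size D <= n)%N -> forall a b, 0 <= a -> a <= b -> b <= tlen w ->
    (forall t, a < t < b -> ~ word_continuous_at w t -> t \in D) ->
    exists2 Ys, all_rows Ys & tsub w a b = tconcat [seq rw Y | Y <- Ys].
  have [_ _ _ /finite_seqP[D hD]] := hw.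
  rewrite -(tsub_id hv); apply: (h (size D) D) => //; first by case: hv.
  move=> t /andP[t0 tN] nc; have : [set` D] t by rewrite -hD; split=> //; rewrite tN ltW.
  by [].
elim: n D => [|n IH] D hD a b a0 ab bN hdis;
  have [[t [/andP[at_ tb] nc]]|hall] :=
    pselect (exists t, a < t < b /\ ~ word_continuous_at w t).
- have := hdis t; rewrite at_ tb => /(_ isT nc).
  by move: hD; rewrite leqn0 => /nilP ->.
- apply: base => // t ht; apply: contrapT => nc; apply: hall.
  by exists t.
- have tD : t \in D by apply: hdis; rewrite ?at_.
  pose D' := [seq x <- D | x != t].
  have hD' : (size D' <= n)%N.
    rewrite -ltnS; apply: leq_trans hD; rewrite size_filter -(count_predC (pred1 t) D).
    by rewrite -add1n leq_add2r -has_count has_pred1.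
  have [||||Ys1 h1 e1] := IH D' hD' a t; try lra.
    move=> s /andP[s1 s2] hs; rewrite mem_filter lt_eqF//=; apply: hdis => //.
    by rewrite s1 (lt_trans s2).
  have [||||Ys2 h2 e2] := IH D' hD' t b; try lra.
    move=> s /andP[s1 s2] hs; rewrite mem_filter gt_eqF//=; apply: hdis => //.
    by rewrite s2 (lt_trans at_).
  exists (Ys1 ++ Ys2); first exact: all_rows_cat.
  rewrite (@tsub_cat _ _ t) ?ltW// e1 e2 map_cat tconcat_cat//.
  by move=> u; rewrite -map_cat; apply: all_rows_total; exact: all_rows_cat.
- apply: base => // t ht; apply: contrapT => nc; apply: hall.
  by exists t.
Qed.

Fixpoint irreducible_rows (Ys : seq (nat -> R)) : Prop :=
  if Ys is Y :: Ys' then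
    [/\ row_vec N Y, 0 < Y N, (if Ys' is Y' :: _ then ~ concat_row N Y Y' else True)
      & irreducible_rows Ys']
  else True.

Lemma irreducible_all_rows Ys : irreducible_rows Ys -> all_rows Ys.
Proof. by elim: Ys => //= Y Ys IH [h1 _ _ /IH]. Qed.

(** Empty rows are dropped and rows that concatenate are merged; by [ins0] and [insD] neither
    affects insertion. This links the rows of a matrix to the row decomposition of its word. *)
Lemma reduce_rows Ys : all_rows Ys ->
  exists Ys', [/\ irreducible_rows Ys',
    tconcat [seq rw (N := N) Y | Y <- Ys'] = tconcat [seq rw (N := N) Y | Y <- Ys] &
    forall T, tab_vec N T -> foldl ins T Ys' = foldl ins T Ys].
Proof.
elim: Ys => [_|Y Ys IH /= [hY /IH [Ys' [h1 h2 h3]]]]; first by exists [::].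
have hall := irreducible_all_rows h1.
have [Y0|Yn0] := eqVneq (Y N) 0.
  exists Ys'; split=> //.
    rewrite (row_vec_eq0 hY Y0) rw0 tcat0w// -h2; apply: total_tconcat => u.
    exact: all_rows_total.
  by move=> T hT; rewrite h3// (row_vec_eq0 hY Y0) (ins0 hT).
have Ypos : 0 < Y N by rewrite lt_neqAle eq_sym Yn0 (row_vec_ge0 hY).
have keep : (if Ys' is Y' :: _ then ~ concat_row N Y Y' else True) ->
    exists Ys'', [/\ irreducible_rows Ys'',
    tconcat [seq rw (N := N) Y | Y <- Ys''] =
      tcat (rw Y) (tconcat [seq rw (N := N) Y | Y <- Ys]) &
    forall T, tab_vec N T -> foldl ins T Ys'' = foldl ins (ins T Y) Ys].
  move=> hn; exists (Y :: Ys'); split=> //=; first by rewrite h2.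
  by move=> T hT; rewrite h3//; exact: tab_vec_ins.
case: Ys' h1 h2 h3 hall keep => [|Y' Ys'] h1 h2 h3 hall keep; first exact: keep.
have [hc|hc] := pselect (concat_row N Y Y'); last exact: keep.
case: h1 => hY' Y'pos hadj hirr.
exists ((fun j => Y j + Y' j) :: Ys'); split=> /=.
- split=> //; [exact: row_vecD|exact: addr_gt0|].
  case: Ys' hadj {h2 h3 hall keep hirr} => // Y'' _ hn hc'; apply: hn => j.
  have [e|e] := hc' j; [left|by right].
  by have := row_vec_leN hY j; have := row_vec_leN hY' j; lra.
- by rewrite -rw_cat// -tcatA ?h2 -?h2//; exact: row_vec_ge0 hY' _.
- by move=> T hT; rewrite (insD hT hY hY' hc) -h3//; exact: tab_vec_ins.
Qed.

(** For [j] with [X j < X N] and [0 < Y j], the letter of [X] at position [X j] is at least [j],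
    while the first letter of [Y] is below [j]. *)
Lemma rw_descent X Y : row_vec N X -> row_vec N Y -> ~ concat_row N X Y ->
  exists t (a b : 'I_N), [/\ 0 <= t < X N, tval (rw X) t = Some a,
    tval (rw Y) 0 = Some b & (b < a)%N].
Proof.
move=> hX hY hn.
have [j Xj Yj] : exists2 j, X j != X N & Y j != 0.
  apply: contrapT => h; apply: hn => j.
  have [e|ne] := eqVneq (X j) (X N); first by left.
  have [e|ne'] := eqVneq (Y j) 0; first by right.
  by case: h; exists j.
have ltX : X j < X N by rewrite lt_neqAle Xj (row_vec_leN hX).
have ltY : 0 < Y j by rewrite lt_neqAle eq_sym Yj (row_vec_ge0 hY).
have ht : 0 <= X j < X N by rewrite (row_vec_ge0 hX).
have [a ha] := total_word_Some (rw_total hX) ht.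
have [b hb] : exists b, tval (rw (N := N) Y) 0 = Some b.
  apply: (total_word_Some (rw_total hY)).
  by rewrite lexx /=; apply: (lt_le_trans ltY); exact: row_vec_leN.
exists (X j), a, b; split=> //.
have /andP[_ h1] := (rw_val _ _ hX).1 ha.
have /andP[h2 _] := (rw_val _ _ hY).1 hb.
apply: (@leq_trans j).
  by rewrite ltnNge; apply/negP => jb; have := row_vec_homo hY jb; lra.
by rewrite -ltnS ltnNge; apply/negP => aj; have := row_vec_homo hX aj; lra.
Qed.

Lemma tcat_descent u v t (a b : 'I_N) : 0 <= t < tlen u -> 0 < tlen v ->
  tval u t = Some a -> tval v 0 = Some b -> (b < a)%N -> ~ timed_row (tcat u v).
Proof.
move=> /andP[t0 tu] v0 ha hb ba [_ /(_ t (tlen u) a b)] /=.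
rewrite tu ltxx subrr => /(_ (ltW tu) ha hb); rewrite leqNgt ba.
by [].
Qed.

Lemma irreducible_decomposition Ys : irreducible_rows Ys ->
  is_row_decomposition (tconcat [seq rw Y | Y <- Ys]) [seq rw (N := N) Y | Y <- Ys].
Proof.
move=> hYs; split=> //.
  elim: Ys hYs => //= Y Ys IH [h1 h2 _ h3] u.
  rewrite inE => /predU1P[->|]; last exact: IH.
  by split=> //; exact: timed_row_rw.
elim: Ys hYs => [//|Y [//|Y' Ys] IH] /= [h1 h2 h3 h4] [_|i]; last exact: (IH h4).
case: h4 => h4 h5 _ _.
have [t [a [b [e1 e2 e3 e4]]]] := rw_descent h1 h4 h3.
exact: (@tcat_descent (rw Y) (rw Y') t a b e1 h5 e2 e3 e4).
Qed.

(** After reduction, two consecutive factors would contain a descent, so a weakly increasing word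
    has at most one factor. *)
Lemma timed_rowP u : timed_row u -> exists2 X, row_vec N X & u = rw X.
Proof.
move=> [hw hu]; have [Ys hYs e] := timed_word_rows hw.
have [Ys' [hirr e' _]] := reduce_rows hYs.
move: e; rewrite -e'; case: Ys' hirr {e'} => [_ ->|X [[hX _ _ _] /= ->|Y Ys']].
- by exists (fun=> 0); rewrite ?rw0.
- by exists X => //; rewrite tcatw0//; exact: rw_total.
move=> [hX X0 hn hirr] /= e; exfalso.
case: hirr => hY Y0 _ _.
have [t [a [b [/andP[t0 tu] ha hb ba]]]] := rw_descent hX hY hn.
have := hu t (X N) a b (ltW tu).
rewrite e [tval _ t]/= tu => /(_ ha); rewrite [tval _ (X N)]/= ltxx subrr Y0 => /(_ hb).
by rewrite leqNgt ba.
Qed.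

Lemma row_decomposition_uniq w s s' :
  is_row_decomposition w s -> is_row_decomposition w s' -> s = s'.
Proof.
move=> [e1 b1 a1] [e2 b2 a2].
apply: (@tconcat_blocks_inj _ _ (fun u => timed_row u /\ 0 < tlen u)
  (fun u v => ~ timed_row (tcat u v))) => //; last by rewrite e1 e2.
  by move=> u [[/timed_word_total hu _] u0].
(* A row extending [u] by the first letter of [v] would contain the descent between [u] and [v]. *)
move=> u v u' [/timed_rowP[X hX ->] X0] [/timed_rowP[Y hY ->] Y0] [[_ hu'] _] hn lt h1 h2.
have hc : ~ concat_row N X Y.
  by move=> hc; apply: hn; rewrite rw_cat//; apply: timed_row_rw; exact: row_vecD.
have [t [a [b [ht ha hb ba]]]] := rw_descent hX hY hc.
have /andP[_ tu] := ht.
have := hu' t (X N) a b (ltW tu); rewrite h1// => /(_ ha).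
by rewrite -[X N]/(tlen (rw X)) h2 => /(_ hb); rewrite leqNgt ba.
Qed.

Lemma rows_eq w s : is_row_decomposition w s -> rows w = s.
Proof.
move=> h; apply: xget_unique => // s' h'; exact: row_decomposition_uniq h' h.
Qed.

Lemma rows_decomposition w : timed_word w -> is_row_decomposition w (rows w).
Proof.
move=> hw; have [Ys hYs ->] := timed_word_rows hw.
have [Ys' [hirr <- _]] := reduce_rows hYs.
by have h := irreducible_decomposition hirr; rewrite (rows_eq h).
Qed.

End RowDecomposition.

(** * Timed tableaux as Gelfand-Tsetlin patterns *)

Section Tableaux.
Context {R : realType} {N : nat}.
Implicit Types (w : tword R N) (X Y : nat -> R) (T : nat -> nat -> R).

(** If [X j < Y j.+1], then at position [X j] the letter of [X] is at least [j] and that of [Y] at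
    most [j]. The inequality is the second half of [interlace]. *)
Lemma dominates_rw X Y : row_vec N X -> row_vec N Y ->
  dominates (rw (N := N) X) (rw Y) <-> forall j, Y j.+1 <= X j.
Proof.
move=> hX hY; split=> [[_ hd] j|hXY].
  rewrite leNgt; apply/negP => lt.
  have ht : 0 <= X j < Y N.
    by rewrite (row_vec_ge0 hX) (lt_le_trans lt)// (row_vec_leN hY).
  have [a [b [/(rw_val _ _ hX)/andP[_ h1] /(rw_val _ _ hY)/andP[h2 _] ab]]] := hd _ ht.
  have [bj|jb] := leqP b j.
    by have := row_vec_homo hX (leq_trans ab bj); lra.
  by have := row_vec_homo hY jb; lra.
split=> /=.
  by apply: le_trans (hXY N); case: hY.
move=> t /andP[t0 tY].
have [b hb] : exists b, tval (rw (N := N) Y) t = Some b.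
  by apply: (total_word_Some (rw_total hY)); rewrite t0.
have /andP[h1 h2] := (rw_val _ _ hY).1 hb.
have hX' : t < X N.
  by apply: (lt_le_trans tY); apply: le_trans (hXY N); case: hY.
have [a ha] : exists a, tval (rw (N := N) X) t = Some a.
  by apply: (total_word_Some (rw_total hX)); rewrite t0.
have /andP[h3 h4] := (rw_val _ _ hX).1 ha.
exists a, b; split=> //; rewrite ltnNge; apply/negP => ba.
by have := row_vec_homo hX ba; have := hXY b; lra.
Qed.

Lemma tab_vec_nparts T : tab_vec N T -> exists p, forall k, (0 < T N k) = (k < p)%N.
Proof.
move=> hT; have ex : exists p, T N p <= 0 by exists N; rewrite (tab_vec_eq0 hT).
case: (ex_minnP ex) => p hp hmin; exists p => k; have [kp|pk] := ltnP k p.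
  by rewrite ltNge; apply/negP => /hmin; rewrite leqNgt kp.
by apply/negbTE; rewrite -leNgt; apply: le_trans hp; exact: tab_vec_nonincr hT pk.
Qed.

Lemma nparts_leq T p : tab_vec N T -> (forall k, (0 < T N k) = (k < p)%N) -> (p <= N)%N.
Proof. by move=> hT hp; rewrite leqNgt -hp (tab_vec_eq0 hT)// ltxx. Qed.

Lemma nparts_row0 T p k : tab_vec N T -> (forall k, (0 < T N k) = (k < p)%N) ->
  (p <= k)%N -> T^~ k = fun=> 0.
Proof.
move=> hT hp pk; have hr := tab_vec_row k hT; apply: (row_vec_eq0 hr).
by apply/eqP; rewrite eq_le (row_vec_ge0 hr) leNgt hp -leqNgt pk.
Qed.

Lemma tab_word_prefix T p : tab_vec N T -> (p <= N)%N ->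
  (forall k, (p <= k)%N -> T^~ k = fun=> 0) ->
  tab_word (N := N) T = tconcat (rev [seq rw (T^~ k) | k <- iota 0 p]).
Proof.
move=> hT pN hp.
have h e : tconcat (rev [seq rw (N := N) (T^~ k) | k <- iota 0 (p + e)]) =
    tconcat (rev [seq rw (T^~ k) | k <- iota 0 p]).
  elim: e => [|e IH]; first by rewrite addn0.
  rewrite addnS -addn1 iotaD map_cat rev_cat /= hp ?leq_addr// rw0 tcat0w//.
  apply: total_tconcat => u; rewrite mem_rev => /mapP[k _ ->].
  by apply: rw_total; exact: tab_vec_row.
by rewrite -(h (N - p)%N) subnKC.
Qed.

Lemma rows_tab_word T p : tab_vec N T -> (forall k, (0 < T N k) = (k < p)%N) ->
  rows (tab_word (N := N) T) = rev [seq rw (T^~ k) | k <- iota 0 p].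
Proof.
move=> hT hp; have hr k := tab_vec_row k hT.
apply: rows_eq; split.
- rewrite -tab_word_prefix//; first exact: nparts_leq hp.
  by move=> k; exact: nparts_row0.
- move=> u; rewrite mem_rev => /mapP[k]; rewrite mem_iota add0n /= => kp ->.
  by split; [exact: timed_row_rw|rewrite /= hp].
- move=> i; rewrite size_rev size_map size_iota => hi.
  rewrite !nth_rev ?size_map ?size_iota ?(ltnW hi)//.
  have [e1 e2] : (p - i.+1 = (p - i.+2).+1)%N /\ (p - i.+2 < p)%N by lia.
  rewrite e1; set k := (p - i.+2)%N in e1 e2 *.
  have kp : (k.+1 < p)%N by lia.
  rewrite !(nth_map 0%N) ?size_iota ?(ltnW kp)// !nth_iota ?(ltnW kp)// !add0n.
  have Y0 : 0 < T N k.+1 by rewrite hp.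
  (* Domination at time 0: row [k.+1], which stands left of row [k] in the word, starts with a
     larger letter, so there is a descent. *)
  have : dominates (rw (N := N) (T^~ k)) (rw (T^~ k.+1)).
    by apply/dominates_rw => // j; case: hT => _ h _; have [] := h j k.
  move=> [_ /(_ 0)]; rewrite lexx Y0 => /(_ isT)[a [b [ha hb ab]]].
  apply: tcat_descent hb ha ab; first by rewrite lexx.
  by rewrite /= hp (ltnW kp).
Qed.

Lemma shape_tab_word T p : tab_vec N T -> (forall k, (0 < T N k) = (k < p)%N) ->
  shape (tab_word (N := N) T) = [seq T N k | k <- iota 0 p].
Proof.
by move=> hT hp; rewrite /shape (rows_tab_word hT hp) revK -map_comp.
Qed.

Lemma timed_tableau_tab_word T : tab_vec N T -> timed_tableau (tab_word (N := N) T).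
Proof.
move=> hT; have hr k := tab_vec_row k hT; split.
  apply: timed_tconcat => u; rewrite mem_rev => /mapP[k _ ->].
  by have [] := timed_row_rw (hr k).
have [p hp] := tab_vec_nparts hT.
rewrite /= (rows_tab_word hT hp) revK => i; rewrite size_map size_iota => hi.
rewrite !(nth_map 0%N) ?size_iota ?(ltnW hi)// !nth_iota ?(ltnW hi)// !add0n.
by apply/dominates_rw => // j; case: hT => _ h _; have [] := h j i.
Qed.

Lemma tab_word_inj T T' : tab_vec N T -> tab_vec N T' ->
  tab_word (N := N) T = tab_word T' -> T = T'.
Proof.
move=> hT hT' e.
have [p hp] := tab_vec_nparts hT; have [p' hp'] := tab_vec_nparts hT'.
have := congr1 (fun w => rev (rows w)) e.
rewrite /= (rows_tab_word hT hp) (rows_tab_word hT' hp') !revK => er.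
have epp : p = p' by have := congr1 size er; rewrite !size_map !size_iota.
subst p'; apply/funext => j; apply/funext => k.
have [kp|pk] := ltnP k p; last first.
  rewrite (congr1 (@^~ j) (nparts_row0 hT hp pk)).
  by rewrite (congr1 (@^~ j) (nparts_row0 hT' hp' pk)).
have := congr1 (fun s => nth tempty s k) er.
rewrite !(nth_map 0%N) ?size_iota// !nth_iota// add0n => /rw_inj h.
by rewrite (congr1 (@^~ j) (h (tab_vec_row k hT) (tab_vec_row k hT'))).
Qed.

Lemma timed_tableauP w : timed_tableau w ->
  exists2 T, tab_vec N T & w = tab_word T.
Proof.
move=> [hw /=]; set us := rev (rows w) => hdom.
have [ew hrow _] := rows_decomposition hw.
have hrow' u : u \in us -> timed_row u /\ 0 < tlen u by rewrite mem_rev; exact: hrow.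
have [F hF] : {F : nat -> nat -> R &
    forall k, row_vec N (F k) /\ nth tempty us k = rw (F k)}.
  apply: (@choice _ _ (fun k X => row_vec N X /\ nth tempty us k = rw X)) => k.
  have [kus|usk] := ltnP k (size us).
    have [/timed_rowP[X hX e] _] := hrow' _ (mem_nth tempty kus).
    by exists X.
  (* Past the last row the zero vector matches the default [tempty] of [nth]. *)
  by exists (fun=> 0); split; rewrite ?rw0 ?nth_default//; exact: row_vec0.
have F0 k : (size us <= k)%N -> F k = fun=> 0.
  move=> hk; have [hr e] := hF k; apply: (rw_inj hr (row_vec0 _)).
  by rewrite -e rw0 nth_default.
pose T j k := F k j.
have hT : tab_vec N T.
  split.
  - by apply/funext => k; have [[]] := hF k.
  - move=> j k; split; first by have [[_ h _] _] := hF k; exact: h.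
    have [kus|usk] := ltnP k.+1 (size us); last first.
      by rewrite /T F0// (row_vec_ge0 (hF k).1).
    have := hdom k kus; rewrite (hF k).2 (hF k.+1).2.
    by move=> hd; exact: (dominates_rw (hF k).1 (hF k.+1).1).1 hd j.
  - by move=> j hj; apply/funext => k; have [[_ _ h] _] := hF k; exact: h.
exists T => //.
(* Column strictness empties row [N], whereas the rows of a decomposition are nonempty. *)
have usN : (size us <= N)%N.
  rewrite leqNgt; apply/negP => lt.
  have [_] := hrow' _ (mem_nth tempty lt); rewrite (hF N).2 /=.
  by rewrite -[F N N]/(T N N) (tab_vec_eq0 hT)// ltxx.
rewrite (tab_word_prefix hT usN); last exact: F0.
rewrite -ew -[rows w]revK -/us; congr (tconcat (rev _)).
apply: (@eq_from_nth _ tempty) => [|k hk]; first by rewrite size_map size_iota.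
by rewrite (nth_map 0%N) ?size_iota// nth_iota// (hF k).2.
Qed.

Lemma insert_tab_word T Y : tab_vec N T -> row_vec N Y ->
  insert (tab_word T) (rw Y) = tab_word (N := N) (ins T Y).
Proof.
move=> hT hY; have [p hp] := tab_vec_nparts hT.
rewrite /insert (rows_tab_word hT hp) revK insert_rows_prefix//.
  exact: nparts_leq hp.
by move=> k; exact: nparts_row0.
Qed.

Lemma Ptab_rows Ys : all_rows (N := N) Ys ->
  Ptab (tconcat [seq rw Y | Y <- Ys]) = tab_word (N := N) (foldl ins (fun _ _ => 0) Ys).
Proof.
move=> hYs; have hT0 := @tab_vec0 R N.
have [Ys' [hirr <- hfold]] := reduce_rows hYs; rewrite -(hfold _ hT0).
rewrite /Ptab (rows_eq (irreducible_decomposition hirr)).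
have := irreducible_all_rows hirr; case: Ys' {hirr hfold} => [_|Y Ys' [hY]] /=.
  by rewrite (@tab_word_prefix _ 0%N).
(* [Ptab] starts with its first row as a tableau, which is the insertion of that row into the empty
   one. *)
have -> : rw Y = tab_word (N := N) (ins (fun _ _ => 0) Y).
  by rewrite -(@insert_rows_prefix _ _ _ _ 0%N).
have := tab_vec_ins hT0 hY; elim: Ys' (ins _ Y) => [//|Y' Ys' IH] T hT [hY' h] /=.
by rewrite insert_tab_word// IH//; exact: tab_vec_ins.
Qed.

End Tableaux.

(** * From a matrix to its growth diagram *)

Section RSKGrowth.
Context {R : realType}.
Implicit Types (m n : nat).

Definition row_sum m n (A : 'M[R]_(m, n)) (i : 'I_m) (j : nat) : R :=
  \sum_(k < n | (k < j)%N) A i k.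

Lemma row_sumS m n (A : 'M[R]_(m, n)) i (j : 'I_n) :
  row_sum A i j.+1 - row_sum A i j = A i j.
Proof.
rewrite /row_sum (bigD1 j) ?ltnSn//= (eq_bigl (fun k : 'I_n => (k < j)%N)); first by ring.
by move=> k; rewrite ltnS ltn_neqAle andbC.
Qed.

Lemma row_vec_row_sum m n (A : 'M[R]_(m, n)) i :
  nonneg_matrices A -> row_vec n (row_sum A i).
Proof.
move=> hA; split.
- by rewrite /row_sum big_pred0.
- move=> j; rewrite /row_sum [leRHS](bigID (fun k : 'I_n => (k < j)%N)) /=.
  rewrite (eq_bigl (fun k : 'I_n => (k < j.+1)%N && (k < j)%N)).
    by rewrite lerDl; apply: sumr_ge0 => k _; exact: hA.
  by move=> k; apply/idP/andP => [h|[]//]; split=> //; exact: leqW.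
- move=> j hj; apply: eq_bigl => k; have := ltn_ord k; lia.
Qed.

Lemma u_word_rows m n (A : 'M[R]_(m, n)) : nonneg_matrices A ->
  u_word A = tconcat [seq rw Y | Y <- [seq row_sum A i | i <- enum 'I_m]].
Proof.
move=> hA; rewrite /u_word -map_comp; elim: (enum 'I_m) => [//|i s IH] /=.
have h0 (l : seq 'I_n) k ct : ct \in [seq (j, A k j) | j <- l] -> 0 <= ct.2.
  by move=> /mapP[j _ ->]; exact: hA.
rewrite texp_cat ?IH.
  congr tcat; rewrite -texp_row_expr; last exact: row_vec_row_sum.
  by rewrite /row_expr; congr texp; apply: eq_map => j; rewrite row_sumS.
move=> ct; rewrite mem_cat => /orP[/h0//|].
by move=> /flatten_mapP[k _ /h0].
Qed.

(** [G i] is the tableau after the first [i] rows of [A]. Quantifying over all extensions [a] of [A]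
    to natural indices lets one extension serve both [A] and its transpose. *)
Lemma growth_diagram_u_word m n (A : 'M[R]_(m, n)) : nonneg_matrices A ->
  exists G : nat -> nat -> nat -> R,
  [/\ forall a : nat -> nat -> R,
        (forall (i : 'I_m) (j : 'I_n), a i j = A i j) -> growth_diagram m n a G,
      tab_vec n (G m) & Ptab (u_word A) = tab_word (N := n) (G m)].
Proof.
move=> hA; pose Ys := [seq row_sum A i | i <- enum 'I_m].
have sYs : size Ys = m by rewrite size_map size_enum_ord.
pose G i := foldl ins (fun _ _ => 0) (take i Ys).
have hY (i : 'I_m) := row_vec_row_sum i hA.
have GS (i : 'I_m) : G i.+1 = ins (G i) (row_sum A i).
  rewrite /G (take_nth (fun=> 0)) ?sYs// foldl_rcons; congr (ins _ _).
  by rewrite (nth_map i) ?size_enum_ord// nth_ord_enum.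
have hG i : (i <= m)%N -> tab_vec n (G i).
  elim: i => [_|i IH im]; first by rewrite /G take0 /=; exact: tab_vec0.
  rewrite (GS (Ordinal im)); apply: tab_vec_ins => //; exact: IH (ltnW im).
exists G; split; last 2 first.
- exact: hG.
- rewrite u_word_rows// Ptab_rows.
    by rewrite /G take_oversize// sYs.
  by elim: (enum 'I_m) => //= i s IH; split.
move=> a ha; split.
- by move=> j _; rewrite /G take0.
- by move=> i /hG[].
- move=> i j im jn; rewrite (GS (Ordinal im)).
  rewrite (@ins_rule _ n)//; last exact: hG (ltnW im).
  by rewrite (row_sumS A (Ordinal im) (Ordinal jn)) -ha.
Qed.

Lemma v_word_tr m n (A : 'M[R]_(m, n)) : v_word A = u_word A^T.
Proof.
rewrite /v_word /u_word; congr texp.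
by apply: eq_allpairs => // j i; rewrite mxE.
Qed.

Lemma matrix_ext m n (A : 'M[R]_(m, n)) :
  exists a : nat -> nat -> R, forall (i : 'I_m) (j : 'I_n), a i j = A i j.
Proof.
exists (fun i j => if insub i is Some i' then
                     if insub j is Some j' then A i' j' else 0 else 0).
by move=> i j; rewrite !valK.
Qed.

Lemma RSK_growth m n (A : 'M[R]_(m, n)) : nonneg_matrices A ->
  exists G P Q,
  [/\ forall a : nat -> nat -> R,
        (forall (i : 'I_m) (j : 'I_n), a i j = A i j) -> growth_diagram m n a G,
      tab_vec n P /\ tab_vec m Q,
      RSK A = (tab_word (N := n) P, tab_word (N := m) Q),
      forall j, (j <= n)%N -> G m j = P j &
      forall i, (i <= m)%N -> G i n = Q i].
Proof.
move=> hA; have hA' : nonneg_matrices A^T by move=> i j; rewrite mxE.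
have [G [hG hP eP]] := growth_diagram_u_word hA.
have [G' [hG' hQ eQ]] := growth_diagram_u_word hA'.
exists G, (G m), (G' n); split=> //; first by rewrite /RSK v_word_tr eP eQ.
move=> i im; have [a ha] := matrix_ext A.
have g' : growth_diagram n m (fun i j => a j i) G'.
  by apply: hG' => k l; rewrite mxE.
exact: (growth_diagram_uniq (hG a ha) (growth_diagram_tr g') im (leqnn n)).
Qed.

End RSKGrowth.

(* The coproduct is the union of the sets Tab_n(l) x Tab_m(l) together with
   their pairwise disjointness. *)
Theorem theorem5p2 (R : realType) (m n : nat) (hm : (0 < m)%N) (hn : (0 < n)%N) :
  let Lambda := [set l : seq R | real_partition l /\ (size l <= minn m n)%N] in
  let TabPairs := fun l : seq R => @Tab R n l `*` @Tab R m l in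
  trivIset Lambda TabPairs /\
  set_bij (@nonneg_matrices R m n) (\bigcup_(l in Lambda) TabPairs l)
          (fun A => RSK A).
Proof.
move=> Lambda TabPairs; split.
  move=> l l' _ _ [[w w'] [/= [[_ <-] _] [[_ <-] _]]].
  by [].
split.
- move=> A hA /=; have [G [P [Q [_ [hP hQ] -> hGP hGQ]]]] := RSK_growth hA.
  (* The corner of the diagram is the common shape; it comes from a tableau in [n] letters and from
     one in [m] letters, whence at most [minn m n] parts. *)
  have PQ : P n = Q m by rewrite -hGP// hGQ.
  have [p hp] := tab_vec_nparts hP.
  have hp' k : (0 < Q m k) = (k < p)%N by rewrite -PQ hp.
  exists [seq P n k | k <- iota 0 p].
    split; last first.
      by rewrite size_map size_iota leq_min (nparts_leq hQ hp') (nparts_leq hP hp).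
    apply/andP; split.
      by apply/allP => x /mapP[k]; rewrite mem_iota add0n /= -hp => ? ->.
    rewrite sorted_map; apply: sub_sorted (iota_ltn_sorted 0 p) => x y xy /=.
    exact: tab_vec_nonincr hP (ltnW xy).
  split; split=> /=.
  + exact: timed_tableau_tab_word.
  + exact: shape_tab_word.
  + exact: timed_tableau_tab_word.
  + by rewrite (shape_tab_word hQ hp') PQ.
- move=> A A' /set_mem hA /set_mem hA'.
  have [G [P [Q [hG [hP hQ] -> hGP hGQ]]]] := RSK_growth hA.
  have [G' [P' [Q' [hG' [hP' hQ'] -> hGP' hGQ']]]] := RSK_growth hA'.
  move=> [/(tab_word_inj hP hP') eP /(tab_word_inj hQ hQ') eQ].
  have [a ha] := matrix_ext A; have [a' ha'] := matrix_ext A'.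
  apply/matrixP => i j; rewrite -ha -ha'.
  apply: (growth_diagram_inj (hG a ha) (hG' a' ha')) => // k hk.
    by rewrite hGP// hGP'// eP.
  by rewrite hGQ// hGQ'// eQ.
- move=> [w w'] [l [_ hl]] [[hw sw] [hw' sw']]; move: sw sw'.
  have [T hT /= ew] := timed_tableauP hw; have [S hS /= ew'] := timed_tableauP hw'.
  have [p hp] := tab_vec_nparts hT; have [q hq] := tab_vec_nparts hS.
  rewrite /= ew ew' (shape_tab_word hT hp) (shape_tab_word hS hq) => <- e.
  have epq : q = p by have := congr1 size e; rewrite !size_map !size_iota.
  have eTS : T n = S m.
    apply/funext => k; have [kp|pk] := ltnP k p; last first.
      by rewrite (congr1 (@^~ n) (nparts_row0 hT hp pk));
         rewrite (congr1 (@^~ m) (nparts_row0 hS hq _))// epq.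
    have := congr1 (fun s => nth 0 s k) e; rewrite epq.
    by rewrite !(nth_map 0%N) ?size_iota// !nth_iota// add0n.
  have cT : gt_chain n T by case: hT.
  have cS : gt_chain m S by case: hS.
  have [a [G [hG a0 GT GS]]] := growth_diagram_surj cT cS eTS.
  pose A : 'M[R]_(m, n) := \matrix_(i, j) a i j.
  have hA : nonneg_matrices A by move=> i j; rewrite mxE.
  have [G' [P [Q [hG' [hP hQ] eA hGP hGQ]]]] := RSK_growth hA.
  have ha (i : 'I_m) (j : 'I_n) : a i j = A i j by rewrite mxE.
  have eG := growth_diagram_uniq (hG' a ha) hG.
  exists A => //; rewrite eA.
  (* The diagram determines a pattern at indices up to [N] only, but patterns are constant from
     there on. *)
  have tab_eq N (T1 T2 : nat -> nat -> R) : tab_vec N T1 -> tab_vec N T2 ->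
      (forall j, (j <= N)%N -> T1 j = T2 j) -> T1 = T2.
    move=> [_ _ h1] [_ _ h2] h; apply/funext => j.
    by have [jN|/ltnW Nj] := leqP j N; [exact: h|rewrite h1// h2// h].
  have -> : P = T.
    by apply: (tab_eq n) => // j jn; rewrite -hGP// eG// GT.
  suff -> : Q = S by [].
  by apply: (tab_eq m) => // i im; rewrite -hGQ// eG// GS.
Qed.
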